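(* Let $k$ be a (possibly non-perfect) field of characteristic $p>0$ and let $Z$ be a regular variety over $k$. Then for each $\xi\in Z$ there exists an open affine neighborhood $\operatorname{Spec}(C)\subset Z$ of $\xi$ such that the ring $C$ admits an absolute $p$-basis.
   Context: A variety over $k$ is in particular a scheme of finite type over $k$. For a ring $C$ of characteristic $p$, put $C^p=\{c^p\mid c\in C\}$, a subring of $C$. A (possibly infinite) subset $\mathcal{B}\subset C$ is an absolute $p$-basis of $C$ if $C$ is a free $C^p$-module with basis the family of $p$-monomials $b_1^{\alpha_1}\cdots b_r^{\alpha_r}$, where $r\in\mathbb{N}$, $b_1,\dots,b_r\in\mathcal{B}$ are distinct, and $0\le\alpha_i<p$. Equivalently, these $p$-monomials are linearly independent over $C^p$ and $C=C^p[\mathcal{B}]$. *)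

(* Defs.v *)
From HB Require Import structures.
From mathcomp Require Import all_boot all_order all_algebra finmap.
From mathcomp Require Import boolp classical_sets topology_structure.

Set Implicit Arguments.
Unset Strict Implicit.
Unset Printing Implicit Defensive.

Import GRing.Theory.
Local Open Scope classical_set_scope.
Local Open Scope ring_scope.

(* Rings are of type comPzRingType, so that the zero ring is allowed: it is   *)
(* the ring of sections of a sheaf over the empty set.  The ideals of         *)
(* mathcomp's ring_quotient are proper, boolean, and restricted to nonzero    *)
(* rings; here ideals are Prop-valued sets and may be the whole ring.         *)

Section CommutativeAlgebra.
Variable A : comPzRingType.
Implicit Types I P m : set A.

Definition ideal I : Prop :=
  [/\ I 0, forall x y, I x -> I y -> I (x + y) & forall a x, I x -> I (a * x)].

Definition prime_ideal P : Prop :=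
  [/\ ideal P, ~ P 1 & forall x y, P (x * y) -> P x \/ P y].

Definition maximal_ideal m : Prop :=
  [/\ ideal m, ~ m 1 & forall I, ideal I -> ~ I 1 -> m `<=` I -> I = m].

Definition ideal_gen n (x : 'I_n -> A) : set A :=
  [set a | exists c : 'I_n -> A, a = \sum_(i < n) c i * x i].

Definition noetherian : Prop :=
  forall I, ideal I -> exists n (x : 'I_n -> A), I = ideal_gen x.

Definition has_prime_chain n : Prop :=
  exists P : nat -> set A,
    (forall i, (i <= n)%N -> prime_ideal (P i)) /\
    (forall i, (i < n)%N -> P i `<` P i.+1).

Definition krull_dim_eq d : Prop :=
  has_prime_chain d /\ forall n, has_prime_chain n -> (n <= d)%N.

Definition local_ring m : Prop :=
  maximal_ideal m /\ forall m', maximal_ideal m' -> m' = m.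

(* The maximal ideal is generated by d elements, d being the Krull dimension. *)
Definition regular_local_ring : Prop :=
  noetherian /\ exists2 m, local_ring m &
    exists2 d, krull_dim_eq d & exists x : 'I_d -> A, m = ideal_gen x.

(* j : A -> B exhibits B as the localization of A at S.                       *)
Definition is_localization (S : set A) (B : comPzRingType) (j : A -> B) :=
  [/\ forall s, S s -> exists b, j s * b = 1,
      forall b, exists a s, S s /\ j s * b = j a
    & forall a, j a = 0 -> exists2 s, S s & s * a = 0].

Definition powers (f : A) : set A := range (fun n : nat => f ^+ n).

End CommutativeAlgebra.

(* A is generated as a k-algebra by finitely many elements, the k-algebra     *)
(* structure being given by iota.                                             *)
Definition finitely_generated_algebra (k : fieldType) (A : comPzRingType)
    (iota : k -> A) : Prop :=
  exists n (x : 'I_n -> A),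
    smallest [set S : set A | subring_closed (mem S)] (range iota `|` range x)
      = setT.

Section PrimeSpectrum.
Variable A : comPzRingType.

Record prime_spectrum : Type := PrimeSpectrum {
  prime_set :> set A;
  prime_setP : prime_ideal prime_set }.

HB.instance Definition _ := gen_eqMixin prime_spectrum.
HB.instance Definition _ := gen_choiceMixin prime_spectrum.

(* Complements of the closed sets V(E) = {P | E is contained in P}.           *)
Definition zariski_open (U : set prime_spectrum) : Prop :=
  exists E : set A, U = [set P : prime_spectrum | ~ (E `<=` P)].

Lemma zariski_openT : zariski_open setT.
Proof.
exists setT; apply/seteqP; split=> // P _ /= sTP.
by case: (prime_setP P) => _ + _; apply; exact: sTP.
Qed.

Lemma zariski_openI : setI_closed zariski_open.
Proof.
move=> _ _ [E ->] [F ->].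
exists [set z | exists x y, [/\ E x, F y & z = x * y]].
apply/seteqP; split=> [P [/= nE nF] sEF | P /= nEF].
  case: (prime_setP P) => _ _ primeP; apply: nF => y Fy.
  apply: contrapT => nPy; apply: nE => x Ex.
  have /primeP[] : prime_set P (x * y) by apply: sEF; exists x, y.
  - by [].
  - by [].
case: (prime_setP P) => -[_ _ PM] _ _.
split=> /= sP; apply: nEF => _ [x [y [Ex Fy ->]]].
  by rewrite mulrC; apply/PM/sP.
exact/PM/sP.
Qed.

Lemma zariski_open_bigU (I : Type) (f : I -> set prime_spectrum) :
  (forall i, zariski_open (f i)) -> zariski_open (\bigcup_i f i).
Proof.
move=> /choice[E fE]; exists (\bigcup_i E i).
apply/seteqP; split=> [P [i _] | P /= nP].
  rewrite fE /= => nEi sP; apply: nEi => x Ex; apply: sP; by exists i.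
apply: contrapT => nU; apply: nP => x [i _ Ex]; apply: contrapT => nPx.
by apply: nU; exists i => //; rewrite fE /= => sE; exact/nPx/sE.
Qed.

HB.instance Definition _ := @isOpenTopological.Build prime_spectrum
  zariski_open zariski_openT zariski_openI zariski_open_bigU.

Definition basic_open (f : A) : set prime_spectrum :=
  [set P : prime_spectrum | ~ prime_set P f].

End PrimeSpectrum.

Record opens (X : topologicalType) : Type := Opens {
  opens_set :> set X;
  opens_open : open opens_set }.

Definition opens_setT (X : topologicalType) : opens X := Opens openT.

(* A topological space with a sheaf of commutative rings.  In sheaf_axiom, s  *)
(* assigns a section to every open set, but only its values on F matter.      *)
Record ringed_space : Type := RingedSpace {
  space :> topologicalType;
  sections : opens space -> comPzRingType;
  res : forall U V : opens space,
    V `<=` U -> {rmorphism sections U -> sections V};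
  res_id : forall (U : opens space) (h : U `<=` U) s, res h s = s;
  res_comp : forall (U V W : opens space) (hVU : V `<=` U) (hWV : W `<=` V)
    (hWU : W `<=` U) s, res hWV (res hVU s) = res hWU s;
  sheaf_axiom : forall (U : opens space) (F : set (opens space)),
    opens_set U = \bigcup_(V in F) opens_set V ->
    forall s : (forall V, sections V),
    (forall (V V' W : opens space) (h : W `<=` V) (h' : W `<=` V'),
      F V -> F V' -> res h (s V) = res h' (s V')) ->
    exists! t : sections U,
      forall (V : opens space) (h : V `<=` U), F V -> res h t = s V }.

Arguments sections {r}.
Arguments res {r U V}.

(* B, with the maps germ, is the stalk at x, i.e. the filtered colimit of the *)
(* rings of sections over the open neighbourhoods of x.                       *)
Record is_stalk (X : ringed_space) (x : X) (B : comPzRingType)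
    (germ : forall U : opens X, opens_set U x -> {rmorphism sections U -> B}) :
    Prop := {
  germ_res : forall (U V : opens X) (hVU : V `<=` U)
    (Ux : opens_set U x) (Vx : opens_set V x) s,
    germ V Vx (res hVU s) = germ U Ux s;
  germ_surj : forall b,
    exists (U : opens X) (Ux : opens_set U x) s, germ U Ux s = b;
  germ_eq0 : forall (U : opens X) (Ux : opens_set U x) s, germ U Ux s = 0 ->
    exists (V : opens X) (hVU : V `<=` U), opens_set V x /\ res hVU s = 0 }.

(* An isomorphism of ringed spaces from Spec A to the open subspace U of X: a *)
(* homeomorphism phi from Spec A to U and a ring morphism theta from A to     *)
(* O(U) such that A -> O(U) -> O(phi(D(f))) is the localization A -> A_f for  *)
(* all f.  This determines the isomorphism of sheaves, because the structure  *)
(* sheaf of Spec A is the sheaf whose value on D(f) is A_f.                   *)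
Record is_spec_chart (X : ringed_space) (U : opens X) (A : comPzRingType)
    (phi : prime_spectrum A -> X) (theta : {rmorphism A -> sections U}) :
    Prop := {
  chart_inj : injective phi;
  chart_range : range phi = U;
  chart_continuous : continuous phi;
  chart_open : forall W : set (prime_spectrum A), open W -> open (phi @` W);
  chart_sections : forall (f : A) (V : opens X) (hVU : V `<=` U),
    opens_set V = phi @` basic_open f ->
    is_localization (powers f) (fun a : A => res hVU (theta a)) }.

Definition affine_open (X : ringed_space) (U : opens X) : Prop :=
  exists (A : comPzRingType) (phi : prime_spectrum A -> X)
    (theta : {rmorphism A -> sections U}), is_spec_chart phi theta.

(* Being local is automatic for the stalks of a ringed space that is locally  *)
(* isomorphic to spectra, so it is not required separately.                   *)
Record scheme : Type := Scheme {
  scheme_space :> ringed_space;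
  scheme_affine : forall x : scheme_space,
    exists2 U : opens scheme_space, opens_set U x & affine_open U }.

Definition regular_scheme (X : scheme) : Prop :=
  forall x : X, exists (B : comPzRingType)
    (germ : forall U : opens X, opens_set U x -> {rmorphism sections U -> B}),
    is_stalk germ /\ regular_local_ring B.

(* A morphism X -> Spec k is the same thing as a ring morphism from k to the  *)
(* global sections of X.  It is of finite type when X is a finite union of    *)
(* affine open sets whose rings are finitely generated k-algebras.            *)
Definition finite_type_over (k : fieldType) (X : scheme)
    (iota : {rmorphism k -> sections (opens_setT X)}) : Prop :=
  exists n (U : 'I_n -> opens X),
    \bigcup_i opens_set (U i) = setT /\
    forall i, affine_open (U i) /\
      finitely_generated_algebra
        (fun c : k => res (U := opens_setT X) (@subsetT _ (U i)) (iota c)).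

(* Only finiteness of type is required of a variety; separatedness or         *)
(* irreducibility, imposed by some authors, are not.                          *)
Record variety (k : fieldType) : Type := Variety {
  variety_scheme :> scheme;
  structure_map : {rmorphism k -> sections (opens_setT variety_scheme)};
  variety_finite_type : finite_type_over structure_map }.

(* The family e, indexed by the elements of D, is a basis of the K-module C,  *)
(* where K is a subring of C.                                                 *)
Definition module_basis (C : comPzRingType) (K : set C)
    (I : choiceType) (D : set I) (e : I -> C) : Prop :=
  (forall (s : seq I) (c : I -> C), uniq s ->
     (forall i, i \in s -> D i /\ K (c i)) ->
     \sum_(i <- s) c i * e i = 0 -> forall i, i \in s -> c i = 0) /\
  (forall x : C, exists (s : seq I) (c : I -> C),
     [/\ uniq s, forall i, i \in s -> D i /\ K (c i)
       & x = \sum_(i <- s) c i * e i]).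

Definition pth_powers (p : nat) (C : comPzRingType) : set C :=
  range (fun c : C => c ^+ p).

(* A p-monomial in the elements of B is given by its exponents, a finitely    *)
(* supported function C -> nat with support in B and values < p.              *)
Definition p_exponent (p : nat) (C : comPzRingType) (B : set C) :
    set {fsfun C -> nat with 0%N} :=
  [set a | forall b, (b \in finsupp a -> B b) /\ (a b < p)%N].

Definition monomial (C : comPzRingType) (a : {fsfun C -> nat with 0%N}) : C :=
  \prod_(b <- finsupp a) b ^+ a b.

Definition absolute_p_basis (p : nat) (C : comPzRingType) (B : set C) : Prop :=
  module_basis (@pth_powers p C) (p_exponent p B) (@monomial C).

(* Main.v *)
(* Let A be the ring of an affine chart of finite type around xi, and P the   *)
(* prime ideal of xi.  Write A as a quotient of a polynomial ring R over k; a *)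
(* p-basis of k and the variables form a p-basis of R.  The preimage of P in  *)
(* R is generated by finitely many elements, which lie in R^p[s] for a finite *)
(* part s of this p-basis; as R is free over R^p[s], the other elements of    *)
(* the p-basis remain p-independent in A / P.  Adding to them a part of s     *)
(* yields a subset T of A that maps to a p-basis of the residue field at P.   *)
(* Let y_1, ..., y_d be a regular system of parameters of the regular local   *)
(* ring A_P.  The ideals (y_1, ..., y_i) are prime, by Krull's principal      *)
(* ideal theorem, and p-independence lifts from A_P / (y_1, ..., y_i) to      *)
(* A_P / (y_1, ..., y_(i-1)) after adjoining y_i: the coefficients of a       *)
(* relation are divisible by all powers of y_i.  Hence T and the y_i are      *)
(* p-independent in A_P.  Finally A is a finite module over A^p[T, y], so     *)
(* that Nakayama's lemma provides g outside P with g A contained in           *)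
(* A^p[T, y]; then T and the y_i form a p-basis of A_g.                       *)

From HB Require Import structures.
Require Import Defs.
From mathcomp Require Import all_boot all_order all_algebra finmap.
From mathcomp Require Import generic_quotient ring zify.
From mathcomp Require Import boolp classical_sets topology_structure.

Set Implicit Arguments.
Unset Strict Implicit.
Unset Printing Implicit Defensive.

Import GRing.Theory.
Local Open Scope classical_set_scope.
Local Open Scope ring_scope.

(** * Ideals and Nakayama's lemma *)

(** A p-basis is found modulo the prime [P] of the point, lifted to the local ring [A_P], and spread
    out to a basic open set.

    Modulo [P], the difficulty is that [k] may have an infinite p-basis.
    [finitely_generated_presentation] extends it to a polynomial ring mapping onto [A], and
    [pfree_set_cofinite] shows that all but finitely many of its elements stay independent modulo
    [P]. The others are sorted by [pfree_set_exchange]; this gives [residual_p_basis_exists], with a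
    set [T] and a finite list [U] such that [A = A^p[T, U]].

    Independence lifts because [A_P] is regular. Its parameters generate primes one after another
    ([regular_flag_of_chain], by [krull_interpolation]). Spans are built from p-th powers, so a
    coefficient that vanishes modulo a parameter [y] is divisible by [y^p] ([pspan_lift]). Dividing
    a relation by [y] can then be repeated forever, which forces its coefficients to vanish
    ([krull_intersection], [pfree_cons_lift]).

    Generation is a finiteness statement: [A] is finite over [E = A^p[T, ys]], and [nakayama] yields
    [g] outside [P] with [g A] inside [E] ([conductor_exists]). By [kernel_annihilator], [g] can be
    chosen so that [A_g] embeds in [A_P], and both halves then hold for [A_g] ([local_p_basis]).
    [stalk_localization] and [basic_chart] translate between the scheme and its rings, and
    [absolute_p_basis_of] turns nested expansions along lists into sums of p-monomials. *)

Section Ideals.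
Variable A : comPzRingType.
Implicit Types (I J P Q : set A) (s W : seq A).

Lemma ideal0 I : ideal I -> I 0. Proof. by case. Qed.

Lemma idealD I x y : ideal I -> I x -> I y -> I (x + y).
Proof. by case=> _ + _; apply. Qed.

Lemma idealMl I a x : ideal I -> I x -> I (a * x).
Proof. by case=> _ _; apply. Qed.

Lemma idealMr I a x : ideal I -> I x -> I (x * a).
Proof. by move=> hI Ix; rewrite mulrC; exact: idealMl. Qed.

Lemma idealN I x : ideal I -> I x -> I (- x).
Proof. by move=> hI Ix; rewrite -mulN1r; exact: idealMl. Qed.

Lemma idealB I x y : ideal I -> I x -> I y -> I (x - y).
Proof. by move=> hI Ix Iy; apply: idealD => //; exact: idealN. Qed.

Lemma ideal_subK I x y : ideal I -> I (x - y) -> I y -> I x.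
Proof. by move=> hI Ixy Iy; rewrite -(subrK y x); exact: idealD. Qed.

Lemma ideal_sum I (T : Type) (r : seq T) (S : pred T) (F : T -> A) :
  ideal I -> (forall i, S i -> I (F i)) -> I (\sum_(i <- r | S i) F i).
Proof.
move=> hI IF; apply: big_ind => [|x y|//]; [exact: ideal0 | exact: idealD].
Qed.

Lemma prime_ideal_ideal P : prime_ideal P -> ideal P. Proof. by case. Qed.

Lemma prime1 P : prime_ideal P -> ~ P 1. Proof. by case. Qed.

Lemma primeM P x y : prime_ideal P -> ~ P x -> ~ P y -> ~ P (x * y).
Proof. by case=> _ _ hP nx ny /hP[]. Qed.

Lemma primeMl P x y : prime_ideal P -> P (x * y) -> ~ P x -> P y.
Proof. by case=> _ _ hP /hP[]. Qed.

Lemma primeX P x n : prime_ideal P -> ~ P x -> ~ P (x ^+ n).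
Proof.
move=> hP nx; elim: n => [|n IH]; first by rewrite expr0; exact: prime1.
by rewrite exprS; exact: primeM.
Qed.

Lemma primeXE P x n : prime_ideal P -> P (x ^+ n) -> P x.
Proof. by move=> hP Px; apply: contrapT => /(primeX (n := n) hP); apply. Qed.

(* The elements z such that z - sum_i c_i W_i lies in J for some c_i in Q.    *)
Fixpoint lincomb Q J W : set A :=
  if W is w :: W' then [set z | exists2 c, Q c & lincomb Q J W' (z - c * w)]
  else J.

Lemma lincomb_base Q J W z : Q 0 -> J z -> lincomb Q J W z.
Proof.
move=> Q0; elim: W z => [//|w W IH] z Jz /=; exists 0 => //.
by rewrite mul0r subr0; exact: IH.
Qed.

Lemma lincombD Q J W x y :
  (forall a b, Q a -> Q b -> Q (a + b)) ->
  (forall a b, J a -> J b -> J (a + b)) ->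
  lincomb Q J W x -> lincomb Q J W y -> lincomb Q J W (x + y).
Proof.
move=> QD JD; elim: W x y => [|w W IH] x y /=; first exact: JD.
move=> [c Qc hx] [d Qd hy]; exists (c + d); first exact: QD.
have -> : x + y - (c + d) * w = (x - c * w) + (y - d * w) by ring.
exact: IH.
Qed.

(** The coefficients and the base may both change, so this covers inclusions ([e = 1]) as well as
    multiplication by an element of a prime, which moves arbitrary coefficients into that prime. *)
Lemma lincombZ Q Q' J J' W e x :
  (forall a, Q a -> Q' (e * a)) -> (forall a, J a -> J' (e * a)) ->
  lincomb Q J W x -> lincomb Q' J' W (e * x).
Proof.
move=> QZ JZ; elim: W x => [|w W IH] x /=; first exact: JZ.
move=> [c Qc hx]; exists (e * c); first exact: QZ.
by rewrite -mulrA -mulrBr; exact: IH.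
Qed.

Lemma lincombS Q Q' J J' W :
  Q `<=` Q' -> J `<=` J' -> lincomb Q J W `<=` lincomb Q' J' W.
Proof.
move=> sQ sJ x hx; rewrite -(mul1r x).
by apply: lincombZ hx => a; rewrite mul1r => ?; [exact: sQ | exact: sJ].
Qed.

Lemma lincomb_mem Q J W c w : Q 0 -> J 0 -> w \in W -> Q c ->
  lincomb Q J W (c * w).
Proof.
move=> Q0 J0 + Qc; elim: W => [//|v W IH].
rewrite inE => /predU1P[->|/IH hw] /=.
  by exists c => //; rewrite subrr; exact: lincomb_base.
by exists 0 => //; rewrite mul0r subr0.
Qed.

Lemma lincomb_sub Q J I W : ideal I -> J `<=` I ->
  (forall w, w \in W -> I w) -> lincomb Q J W `<=` I.
Proof.
move=> hI sJ; elim: W => [//|w W IH] sW z [c _ hz].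
apply: (ideal_subK hI (y := c * w)).
  by apply: IH hz => v vW; apply: sW; rewrite inE vW orbT.
by apply: idealMl => //; apply: sW; rewrite mem_head.
Qed.

Lemma lincomb_ideal J W : ideal J -> ideal (lincomb setT J W).
Proof.
move=> hJ; split=> [|x y|a x].
- by apply: lincomb_base => //; exact: ideal0.
- by apply: lincombD => // u v; exact: idealD.
- by apply: lincombZ => // u; exact: idealMl.
Qed.

(** A generator can be absorbed into the base ideal; this is how parameters are divided out one at a
    time. *)
Lemma lincomb_cons J w W z :
  lincomb setT J (w :: W) z <-> lincomb setT (lincomb setT J [:: w]) W z.
Proof.
elim: W z => [//|v W IH] z /=; split.
  move=> [c _ [d _ h]]; exists d => //; apply/IH; exists c => //.
  by rewrite addrAC.
by move=> [d _ /IH[c _ h]]; exists c => //; exists d => //; rewrite addrAC.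
Qed.

Lemma zero_ideal : ideal [set (0 : A)].
Proof.
by split=> // [x y -> ->|a x ->]; rewrite /= ?addr0 ?mulr0.
Qed.

Definition generated s := lincomb setT [set 0] s.

Lemma generated_ideal s : ideal (generated s).
Proof. exact: lincomb_ideal zero_ideal. Qed.

Lemma generated_mem s x : x \in s -> generated s x.
Proof. by move=> xs; rewrite -[x]mul1r; exact: lincomb_mem. Qed.

Lemma generated_min s I : ideal I -> (forall x, x \in s -> I x) ->
  generated s `<=` I.
Proof. by move=> hI sI; apply: lincomb_sub => // _ ->; exact: ideal0. Qed.

Lemma generatedS s s' : {subset s <= s'} -> generated s `<=` generated s'.
Proof.
move=> ss; apply: generated_min; first exact: generated_ideal.
by move=> x /ss; exact: generated_mem.
Qed.

Lemma ideal_gen_ideal n (x : 'I_n -> A) : ideal (ideal_gen x).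
Proof.
split=> [|_ _ [c ->] [d ->]|a _ [c ->]].
- by exists (fun=> 0); rewrite big1 // => i _; rewrite mul0r.
- exists (fun i => c i + d i); rewrite -big_split /=.
  by apply: eq_bigr => i _; rewrite mulrDl.
- exists (fun i => a * c i); rewrite big_distrr /=.
  by apply: eq_bigr => i _; rewrite mulrA.
Qed.

Lemma ideal_genE n (x : 'I_n -> A) : ideal_gen x = generated (codom x).
Proof.
apply/seteqP; split=> [_ [c ->]|].
  apply: ideal_sum => [|i _]; first exact: generated_ideal.
  by apply: idealMl; [exact: generated_ideal|apply: generated_mem;
    exact: codom_f].
apply: generated_min => [|_ /codomP[i ->]]; first exact: ideal_gen_ideal.
exists (fun j => (j == i)%:R); rewrite (bigD1 i) //= eqxx mul1r big1 ?addr0 //.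
by move=> j /negPf->; rewrite mul0r.
Qed.

Lemma generatedE s : generated s = ideal_gen (fun i : 'I_(size s) => s`_i).
Proof.
rewrite ideal_genE; congr generated.
rewrite /codom /image_mem (map_comp (nth 0 s) val) val_enum_ord.
by rewrite map_nth_iota0 // take_size.
Qed.

Lemma noetherianE : noetherian A <-> forall I, ideal I ->
  exists s, I = generated s.
Proof.
split=> hA I /hA [].
  by move=> n [x ->]; exists (codom x); rewrite ideal_genE.
by move=> s ->; exists (size s), (fun i => s`_i); rewrite generatedE.
Qed.

End Ideals.

(** * Noetherian rings, subrings and saturated ideals *)

Section Noetherian.
Variable A : comPzRingType.
Implicit Types (I J P Q E : set A) (W : seq A).

Lemma noetherian_max (F : set (set A)) I0 : noetherian A ->
  F `<=` @ideal A -> F I0 ->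
  exists2 M, F M & forall I, F I -> M `<=` I -> I `<=` M.
Proof.
move=> /noetherianE hA Fid FI0.
pose G X := X = set0 \/ F X.
have [|M [GM maxM]] := @Zorn_bigcup A G.
  move=> C CG Ctot.
  have [Fex|nF] := pselect (exists2 X, C X & F X); last first.
    left; rewrite -subset0 => x [X CX Xx].
    by have [X0|FX] := CG _ CX; [move: Xx; rewrite X0 | case: nF; exists X].
  have [X0 CX0 FX0] := Fex; right.
  have Cid X x : C X -> X x -> ideal X.
    by move=> CX Xx; have [X_0|/Fid//] := CG _ CX; move: Xx; rewrite X_0.
  have hU : ideal (\bigcup_(X in C) X).
    split=> [|x y [X CX Xx] [Y CY Yy]|a x [X CX Xx]].
    - by exists X0 => //; exact: ideal0 (Fid _ FX0).
    - have [sXY|sYX] := Ctot _ _ CX CY.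
      + by exists Y => //; apply: idealD => //; [exact: Cid Yy | exact: sXY].
      + by exists X => //; apply: idealD => //; [exact: Cid Xx | exact: sYX].
    - by exists X => //; apply: idealMl => //; exact: Cid Xx.
  have [s es] := hA _ hU.
  have [X [CX FX sX]] : exists X, [/\ C X, F X & forall x, x \in s -> X x].
    have : forall x, x \in s -> (\bigcup_(X in C) X) x.
      by rewrite es => x; exact: generated_mem.
    elim: {es} s => [_|x s IH hs]; first by exists X0.
    have [X [CX FX sX]] := IH (fun z zs => hs z (mem_behead (s := x :: s) zs)).
    have [Y CY Yx] := hs x (mem_head _ _).
    have FY : F Y by have [Y0|//] := CG _ CY; move: Yx; rewrite Y0.
    have [sXY|sYX] := Ctot _ _ CX CY.
      by exists Y; split=> // z; rewrite inE => /predU1P[->//|/sX/sXY].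
    by exists X; split=> // z; rewrite inE => /predU1P[->|/sX//]; exact: sYX.
  suff -> : \bigcup_(X in C) X = X by [].
  apply/seteqP; split; last by move=> x Xx; exists X.
  by rewrite es; apply: generated_min => //; exact: Fid.
have FM : F M.
  case: GM => // M0; exfalso; apply: (maxM I0); last by right.
  rewrite M0; split; first exact: sub0set.
  by move=> /(_ 0 (ideal0 (Fid _ FI0))).
exists M => // I FI sMI; apply: contrapT => nIM.
by apply: (maxM I); [split | right].
Qed.

Lemma noetherian_acc (I : nat -> set A) : noetherian A ->
  (forall n, ideal (I n)) -> (forall n, I n `<=` I n.+1) ->
  exists n, I n.+1 `<=` I n.
Proof.
move=> hA hI sI.
have [||M [n _ eM] maxM] := @noetherian_max (range I) (I 0%N) hA.
- by move=> _ [n _ <-].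
- by exists 0%N.
by exists n; rewrite eM; apply: maxM; [exists n.+1 | rewrite -eM].
Qed.

Definition subring E :=
  [/\ E 1, forall x y, E x -> E y -> E (x - y)
    & forall x y, E x -> E y -> E (x * y)].

Lemma subring0 E : subring E -> E 0.
Proof. by case=> E1 EB _; rewrite -(subrr 1); exact: EB. Qed.

Lemma subring1 E : subring E -> E 1. Proof. by case. Qed.

Lemma subringM E x y : subring E -> E x -> E y -> E (x * y).
Proof. by case=> _ _; apply. Qed.

Lemma subringB E x y : subring E -> E x -> E y -> E (x - y).
Proof. by case=> _ + _; apply. Qed.

Lemma subringN E x : subring E -> E x -> E (- x).
Proof. by move=> hE Ex; rewrite -sub0r; apply: subringB => //;
  exact: subring0. Qed.

Lemma subringD E x y : subring E -> E x -> E y -> E (x + y).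
Proof.
by move=> hE Ex Ey; rewrite -[y]opprK; apply: subringB => //; exact: subringN.
Qed.

Lemma subringX E x n : subring E -> E x -> E (x ^+ n).
Proof.
move=> hE Ex; elim: n => [|n IH]; first by rewrite expr0; exact: subring1.
by rewrite exprS; exact: subringM.
Qed.

Lemma subring_sum E (T : Type) (r : seq T) (S : pred T) (F : T -> A) :
  subring E -> (forall i, S i -> E (F i)) -> E (\sum_(i <- r | S i) F i).
Proof.
move=> hE EF; apply: big_ind => [|x y|//]; [exact: subring0 | exact: subringD].
Qed.

Lemma subring_nat E n : subring E -> E n%:R.
Proof.
by move=> hE; elim: n => [|n IH]; [exact: subring0|rewrite mulrS;
  apply: subringD => //; exact: subring1].
Qed.

Lemma subringT : subring setT. Proof. by []. Qed.

(* Nakayama's lemma for the E-module J + sum_i E W_i, where E is a subring    *)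
(* localized at the contraction of the prime P: the generators W_i are        *)
(* eliminated one at a time.                                                  *)
Lemma nakayama E P J W : subring E -> prime_ideal P ->
  J 0 -> (forall x y, J x -> J y -> J (x + y)) ->
  (forall a x, E a -> J x -> J (a * x)) ->
  (forall w, w \in W ->
     exists s, [/\ E s, ~ P s & lincomb (E `&` P) J W (s * w)]) ->
  exists g, [/\ E g, ~ P g & forall w, w \in W -> J (g * w)].
Proof.
move=> hE hP J0 JD JM; have hPi := prime_ideal_ideal hP.
have lD V x y : lincomb (E `&` P) J V x -> lincomb (E `&` P) J V y ->
    lincomb (E `&` P) J V (x + y).
  apply: lincombD => // a b [Ea Pa] [Eb Pb].
  by split; [exact: subringD | exact: idealD].
have lM V a x : E a -> lincomb (E `&` P) J V x -> lincomb (E `&` P) J V (a * x).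
  move=> Ea; apply: lincombZ => [b [Eb Pb]|b]; last exact: JM.
  by split; [exact: subringM | exact: idealMl].
elim: W => [_|w W IH hW]; first by exists 1; split=> //;
  [exact: subring1 | exact: prime1].
have [s [Es nPs [m [Em Pm] hw]]] := hW w (mem_head _ _).
(* Moving [m w] to the left expresses [(s - m) w] through the remaining generators, and [s - m] is
   still outside [P]. *)
rewrite -mulrBl in hw.
have Et : E (s - m) by exact: subringB.
have nPt : ~ P (s - m) by move=> /(ideal_subK hPi)/(_ Pm).
have [|g [Eg nPg gW]] := IH.
  move=> v vW; have [s' [Es' nPs' [m' [Em' Pm'] hv]]] : exists s', _ :=
    hW v (mem_behead (s := w :: W) vW).
  exists ((s - m) * s'); split; [exact: subringM | exact: primeM |].
  have -> : (s - m) * s' * v = (s - m) * (s' * v - m' * w) + m' * ((s - m) * w).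
    by ring.
  by apply: lD; exact: lM.
exists (g * (s - m)); split; [exact: subringM | exact: primeM |].
have gl V z : (forall v, v \in V -> J (g * v)) -> lincomb (E `&` P) J V z ->
  J (g * z).
  elim: V z => [|v V IHV] z gV /=; first exact: JM.
  move=> [c [Ec _] hz].
  have -> : g * z = g * (z - c * v) + c * (g * v) by ring.
  apply: JD; first by apply: IHV hz => u uV; apply: gV; rewrite inE uV orbT.
  by apply: JM => //; apply: gV; exact: mem_head.
move=> v; rewrite inE -mulrA => /predU1P[->|vW]; first exact: gl hw.
by rewrite mulrCA; apply: JM => //; exact: gW.
Qed.

(** For prime [Q], saturated ideals are the contractions of ideals of the localization at [Q]; they
    stand in for that localization, which is never constructed here. *)
Definition saturated Q J := forall t x, ~ Q t -> J (t * x) -> J x.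

Definition saturation Q J : set A := [set x | exists2 t, ~ Q t & J (t * x)].

Lemma saturation_ideal Q J : prime_ideal Q -> ideal J -> ideal (saturation Q J).
Proof.
move=> hQ hJ; split=> [|x y [t nt Jx] [u nu Jy]|a x [t nt Jx]].
- by exists 1; [exact: prime1 | rewrite mulr0; exact: ideal0].
- exists (t * u); first exact: primeM.
  have -> : t * u * (x + y) = u * (t * x) + t * (u * y) by ring.
  by apply: idealD => //; exact: idealMl.
- by exists t => //; rewrite mulrCA; exact: idealMl.
Qed.

Lemma saturation_saturated Q J : prime_ideal Q -> saturated Q (saturation Q J).
Proof.
move=> hQ t x nt [u nu Jx]; exists (u * t); first exact: primeM.
by rewrite -mulrA.
Qed.

Lemma sub_saturation Q J : prime_ideal Q -> J `<=` saturation Q J.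
Proof. by move=> hQ x Jx; exists 1; [exact: prime1 | rewrite mul1r]. Qed.

Lemma saturationS Q J J' : J `<=` J' -> saturation Q J `<=` saturation Q J'.
Proof. by move=> sJ x [t nt Jx]; exists t => //; exact: sJ. Qed.

Lemma saturated_sub Q J : saturated Q J -> ~ J 1 -> J `<=` Q.
Proof.
move=> sJ nJ1 x Jx; apply: contrapT => nQx; apply: nJ1.
by apply: (sJ x) => //; rewrite mulr1.
Qed.

(* Noetherian induction in place of the theory of modules of finite length:   *)
(* if ab lies in I, a chain above I stabilizes when the chains J_n + (a) and  *)
(* (J_n : a) do.                                                              *)
Lemma saturated_dcc Q I0 (J : nat -> set A) : noetherian A -> prime_ideal Q ->
  (forall Q', prime_ideal Q' -> I0 `<=` Q' -> Q' `<=` Q -> Q `<=` Q') ->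
  ideal I0 -> saturated Q I0 ->
  (forall n, [/\ ideal (J n), saturated Q (J n),
    I0 `<=` J n & J n.+1 `<=` J n]) ->
  exists N, forall n, (N <= n)%N -> J n `<=` J n.+1.
Proof.
move=> hA hQ minQ hI0 satI0.
pose good I := forall J : nat -> set A,
  (forall n, [/\ ideal (J n), saturated Q (J n),
    I `<=` J n & J n.+1 `<=` J n]) ->
  exists N, forall n, (N <= n)%N -> J n `<=` J n.+1.
suff : good I0 by apply.
apply: contrapT => bad0.
pose F I := [/\ ideal I, saturated Q I, I0 `<=` I & ~ good I].
have [|| M [hM satM sM badM] maxM] := @noetherian_max F I0 hA.
- by move=> I [].
- by split.
have goodM I : ideal I -> saturated Q I -> M `<=` I -> ~ I `<=` M -> good I.
  move=> hI satI sI nIM; apply: contrapT => badI; apply/nIM/maxM => //.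
  by split=> //; exact: subset_trans sI.
have nM1 : ~ M 1.
  move=> M1; apply: badM => K hK; exists 0%N => n _ x _.
  have [hKn _ sKn _] := hK n.+1.
  by rewrite -(mulr1 x); apply: idealMl => //; exact: sKn.
have sMQ : M `<=` Q by exact: saturated_sub.
have [[a [b [Mab nMa nMb]]]|nab] :=
    pselect (exists a b, [/\ M (a * b), ~ M a & ~ M b]); last first.
  (* A prime [M] equals [Q] by minimality. A saturated ideal without 1 lies in [Q], so the chain is
     either equal to [Q] from some index on or always the whole ring. *)
  have pM : prime_ideal M.
    split=> // a b Mab; have [Ma|nMa] := pselect (M a); first by left.
    by right; apply: contrapT => nMb; apply: nab; exists a, b.
  have sQM := minQ _ pM sM sMQ.
  apply: badM => K hK.
  have mono n m : (n <= m)%N -> K m `<=` K n.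
    move=> /subnK<-; elim: (m - n)%N => [//|i IH] x.
    by have [_ _ _ sK] := hK (i + n)%N => /sK/IH.
  have [[N nN]|all1] := pselect (exists N, ~ K N 1).
    exists N => n leNn; have [_ _ sMK _] := hK n.+1.
    have [_ satK _ _] := hK N.
    apply: subset_trans sMK; apply: subset_trans sQM.
    apply: subset_trans (mono _ _ leNn) _; exact: saturated_sub.
  exists 0%N => n _ x _.
  have [hKn _ _ _] := hK n.+1; rewrite -(mulr1 x); apply: idealMl => //.
  by apply: contrapT => nK; apply: all1; exists n.+1.
apply: badM => K hK.
pose Ka n := saturation Q (lincomb setT (K n) [:: a]).
pose Kc n : set A := [set x | K n (a * x)].
have hKa n : [/\ ideal (Ka n), saturated Q (Ka n),
    saturation Q (lincomb setT M [:: a]) `<=` Ka n & Ka n.+1 `<=` Ka n].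
  have [hKn satK sKn sKSn] := hK n; split.
  - exact/saturation_ideal/lincomb_ideal.
  - exact: saturation_saturated.
  - exact/saturationS/lincombS.
  - exact/saturationS/lincombS.
have hKc n : [/\ ideal (Kc n), saturated Q (Kc n),
    (fun x => M (a * x)) `<=` Kc n & Kc n.+1 `<=` Kc n].
  have [hKn satK sKn sKSn] := hK n; split.
  - split=> [|x y|c x]; rewrite /Kc /= ?mulr0 ?mulrDr.
    + exact: ideal0.
    + exact: idealD.
    + by rewrite mulrCA; exact: idealMl.
  - by move=> t x nt; rewrite /Kc /= mulrCA; exact: satK.
  - by move=> x; exact: sKn.
  - by move=> x; exact: sKSn.
(* Both ideals used here and below are strictly larger than [M]: the first contains [a], the second
   contains [b]. *)
have [||||N1 stab1] := goodM (saturation Q (lincomb setT M [:: a])) _ _ _ _ Ka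
  hKa.
- exact/saturation_ideal/lincomb_ideal.
- exact: saturation_saturated.
- move=> x Mx; apply: sub_saturation => //; exact: lincomb_base.
- move=> /(_ a) sub; apply/nMa/sub/sub_saturation => //.
  by exists 1 => //=; rewrite mul1r subrr; exact: ideal0.
have [||||N2 stab2] := goodM (fun x => M (a * x)) _ _ _ _ Kc hKc.
- split=> [|x y|c x]; rewrite ?mulr0 ?mulrDr.
  + exact: ideal0.
  + exact: idealD.
  + by rewrite mulrCA; exact: idealMl.
- by move=> t x nt; rewrite mulrCA; exact: satM.
- by move=> x Mx; exact: idealMl.
- by move=> /(_ b) sub; apply/nMb/sub.
exists (maxn N1 N2) => n; rewrite geq_max => /andP[le1 le2] x Kx.
have [hKn satKn _ sKSn] := hK n; have [hKSn satKSn _ _] := hK n.+1.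
(* Modulo [K n.+1], [t x] is [c a]. Then [c a] lies in [K n], so [c] lies in [Kc n], hence in
   [Kc n.+1], and [c a] lies in [K n.+1]. *)
have [t nt [c _ /= hc]] : Ka n.+1 x.
  by apply: stab1 => //; apply: sub_saturation => //; exact: lincomb_base.
apply: (satKSn t) => //; apply: (ideal_subK hKSn hc); rewrite mulrC.
apply: stab2 => //; rewrite /Kc /= mulrC -[_ * _](subKr (t * x)).
by apply: idealB => //; [exact: idealMl | exact: sKSn].
Qed.

End Noetherian.

(** * Regular local rings *)

Section Regular.
Variable A : comPzRingType.
Implicit Types (I J P Q E m : set A) (W ys : seq A).

(* A form of Krull's principal ideal theorem.  Otherwise Q2 is minimal over   *)
(* Q0 + (y); then the chain of the contractions to A of the ideals Q0 + (x^n) *)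
(* of the localization at Q1, for x in Q1 outside Q0, stabilizes modulo y,    *)
(* hence stabilizes by Nakayama's lemma.                                      *)
Lemma krull_interpolation Q0 Q1 Q2 y : noetherian A ->
  prime_ideal Q0 -> prime_ideal Q1 -> prime_ideal Q2 ->
  Q0 `<` Q1 -> Q1 `<` Q2 -> Q2 y ->
  exists Q, [/\ prime_ideal Q, Q0 `<` Q, Q `<` Q2 & Q y].
Proof.
move=> hA pQ0 pQ1 pQ2 [s01 n10] lt12 Q2y; have [s12 n21] := lt12.
have iQ0 := prime_ideal_ideal pQ0; have iQ1 := prime_ideal_ideal pQ1.
have [Q1y|nQ1y] := pselect (Q1 y); first by exists Q1.
apply: contrapT => noQ.
have minQ2 Q' : prime_ideal Q' ->
    saturation Q2 (lincomb setT Q0 [:: y]) `<=` Q' ->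
    Q' `<=` Q2 -> Q2 `<=` Q'.
  move=> pQ' sQ' sQ'2.
  have Q'y : Q' y.
    apply: sQ'; apply: sub_saturation => //; exists 1 => //=.
    by rewrite mul1r subrr; exact: ideal0.
  have s0 : Q0 `<=` Q'.
    by move=> x Qx; apply/sQ'/sub_saturation => //; exact: lincomb_base.
  apply: contrapT => nQ'; apply: noQ; exists Q'; split=> //; split=> //.
  by move=> /(_ _ Q'y)/s01.
have [x [Q1x nQ0x]] : exists x, Q1 x /\ ~ Q0 x.
  apply: contrapT => nx; apply: n10 => x Q1x; apply: contrapT => nQ0x.
  by apply: nx; exists x.
pose J n := saturation Q1 (lincomb setT Q0 [:: x ^+ n]).
have hJ n : ideal (J n) by exact/saturation_ideal/lincomb_ideal.
have satJ n : saturated Q1 (J n) by exact: saturation_saturated.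
have sJ n : J n.+1 `<=` J n.
  apply: saturationS => z /= [c _ hc]; exists (c * x) => //.
  by rewrite -mulrA -exprS.
have [||n|N stab] := @saturated_dcc _ Q2 _
    (fun n => saturation Q2 (lincomb setT (J n) [:: y])) hA pQ2 minQ2.
- exact/saturation_ideal/lincomb_ideal.
- exact: saturation_saturated.
- split.
  + exact/saturation_ideal/lincomb_ideal.
  + exact: saturation_saturated.
  + apply/saturationS/lincombS => // z Q0z.
    by apply: sub_saturation => //; exact: lincomb_base.
  + exact/saturationS/lincombS.
have [s es] := (noetherianE A).1 hA _ (hJ N).
have [|||w ws|g [_ nQ2g gs]] := @nakayama _ setT Q2 (J N.+1) s (subringT A) pQ2.
- exact: ideal0.
- by move=> a b; exact: idealD.
- by move=> a b _; exact: idealMl.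
- have JNw : J N w by rewrite es; exact: generated_mem.
  have [t nt [c _ /= hc]] : saturation Q2 (lincomb setT (J N.+1) [:: y]) w.
    by apply: stab => //; apply: sub_saturation => //; exact: lincomb_base.
  exists t; split=> //.
  (* [c y] lies in [J N], which is saturated at [Q1], and [y] is outside [Q1]. So [J N] is
     [J N.+1 + y (J N)] locally at [Q2], as Nakayama's lemma needs. *)
  have Jc : J N c.
    apply: (satJ N y) => //; rewrite mulrC -[_ * _](subKr (t * w)).
    by apply: idealB => //; [exact: idealMl | exact: sJ].
  rewrite -(subrK (c * y) (t * w)); apply: lincombD.
  + by move=> a b [_ Qa] [_ Qb]; split=> //; apply: idealD => //; case: pQ2.
  + by move=> a b; exact: idealD.
  + by apply: lincomb_base => //; split=> //; apply: ideal0; case: pQ2.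
  + rewrite mulrC; move: Jc; rewrite es; apply: lincombZ => [a _|_ ->].
      by split=> //; apply: idealMr => //; case: pQ2.
    by rewrite mulr0; exact: ideal0.
have sJN : J N `<=` J N.+1.
  rewrite es; apply: generated_min => // w /gs; apply: satJ => Q1g.
  by apply: nQ2g; exact: s12.
(* This says that [x^N (t - c x)] lies in [Q0]. As [x] is not in [Q0], [t - c x] is in [Q0]; since
   [x] is in [Q1], so is [t], a contradiction. *)
have [t nQ1t [c _ /=]] : J N.+1 (x ^+ N).
  apply: sJN; apply: sub_saturation => //; exists 1 => //=.
  by rewrite mul1r subrr; exact: ideal0.
rewrite exprSr mulrCA [t * _]mulrC -mulrBr.
move=> /(primeMl pQ0)/(_ (primeX pQ0 nQ0x))/s01.
by move=> /(ideal_subK iQ1) h; apply: nQ1t; apply: h; exact: idealMl.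
Qed.

Definition local_at m :=
  prime_ideal m /\ forall x, ~ m x -> exists z, x * z = 1.

Lemma local_prime_sub m P : local_at m -> prime_ideal P -> P `<=` m.
Proof.
move=> [_ unitm] hP x Px; apply: contrapT => /unitm[z xz1].
by case: (prime1 hP); rewrite -xz1; apply: idealMr => //; case: hP.
Qed.

Fixpoint prime_chain_from n Q : Prop := prime_ideal Q /\
  if n is n'.+1 then exists2 Q', Q `<` Q' & prime_chain_from n' Q' else True.

Lemma prime_chain_from_prime n Q : prime_chain_from n Q -> prime_ideal Q.
Proof. by case: n => [|n] []. Qed.

(** At the top of the chain a prime can be replaced by [m], which contains [y]; interpolation then
    moves [y] down one prime at a time. In effect, dividing by one element lowers the dimension by
    at most one. *)
Lemma prime_chain_through m n Q y : noetherian A -> local_at m -> m y ->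
  prime_chain_from n.+1 Q ->
  exists Q', [/\ Q' y, Q `<` Q' & prime_chain_from n Q'].
Proof.
move=> hA hm my; elim: n Q => [|n IH] Q [pQ [Q1 ltQ]].
  move=> [pQ1 _]; exists m; split=> //; last by split=> //; case: hm.
  have sQ1m := local_prime_sub hm pQ1; case: ltQ => sQ nQ.
  by split=> [|smQ]; [exact: subset_trans sQ1m | apply: nQ;
    exact: subset_trans smQ].
move=> hQ1; have [Q2 [Q2y lt12 hQ2]] := IH _ hQ1.
have [Q' [pQ' lt lt' Q'y]] := krull_interpolation hA pQ
  hQ1.1 (prime_chain_from_prime hQ2) ltQ lt12 Q2y.
by exists Q'; split=> //; split=> //; exists Q2.
Qed.

(* ys is a regular system of parameters modulo I. *)
Fixpoint regular_flag m I ys : Prop :=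
  if ys is y :: ys' then
    [/\ prime_ideal I, ~ I y, m y & regular_flag m (lincomb setT I [:: y]) ys']
  else I = m.

(** By induction [I + (y)] is a prime [Q'] strictly above [Q], so [y] is not in [Q]. Every element
    of [Q] is then [c y] modulo [I] with [c] in [Q], that is [Q = I + y Q], and Nakayama's lemma
    gives [Q = I]. The number of generators matching the length of the chain is what makes [I]
    prime. *)
Lemma regular_flag_of_chain m I ys Q : noetherian A -> local_at m ->
  ideal I -> I `<=` Q -> prime_chain_from (size ys) Q ->
  (forall z, m z <-> lincomb setT I ys z) ->
  regular_flag m I ys /\ I = Q.
Proof.
move=> hA hm; elim: ys I Q => [|y ys IH] I Q hI sIQ /=.
  move=> [pQ _] em; have eI : I = m by apply/seteqP; split=> z /em.
  split=> //; apply/seteqP; split=> //; rewrite eI; exact: local_prime_sub.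
move=> hQ em; have [pQ _] := hQ.
have my : m y.
  apply/em; exists 1 => //; rewrite mul1r subrr; apply: lincomb_base => //.
  exact: ideal0.
have [Q' [Q'y ltQ hQ']] := prime_chain_through hA hm my hQ.
have pQ' := prime_chain_from_prime hQ'.
have Iy : lincomb setT I [:: y] y.
  by exists 1 => //=; rewrite mul1r subrr; exact: ideal0.
have [||||flag eQ'] := IH (lincomb setT I [:: y]) Q'.
- exact: lincomb_ideal.
- apply: lincomb_sub; first by case: pQ'.
  + by apply: subset_trans sIQ _; case: ltQ.
  + by move=> w; rewrite inE => /eqP->.
- by [].
- by move=> z; rewrite em; exact: lincomb_cons.
have nQy : ~ Q y.
  move=> Qy; have [_] := ltQ; apply; rewrite -eQ'; apply: lincomb_sub => //.
    by case: pQ.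
  by move=> w; rewrite inE => /eqP->.
suff eIQ : I = Q by split=> //; split=> //; rewrite eIQ.
apply/seteqP; split=> // z Qz.
have [s es] := (noetherianE A).1 hA _ (prime_ideal_ideal pQ).
have pm : prime_ideal m by case: hm.
have [||||g [_ nmg gI]] := @nakayama _ setT m I s (subringT A) pm.
- exact: ideal0.
- by move=> a b; exact: idealD.
- by move=> a b _; exact: idealMl.
- move=> w ws; exists 1; split=> //; first exact: prime1.
  have Qw : Q w by rewrite es; exact: generated_mem.
  have [c _ /= hc] : lincomb setT I [:: y] w by rewrite eQ'; case: ltQ => + _;
    apply.
  rewrite mul1r -(subrK (c * y) w); apply: lincombD.
  + by move=> a b [_ Qa] [_ Qb]; split=> //; apply: idealD => //; case: pm.
  + by move=> a b; exact: idealD.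
  + by apply: lincomb_base => //; split=> //; apply: ideal0; case: pm.
  + have Qc : Q c.
      apply: contrapT => nQc; apply: (primeM pQ nQc nQy).
      rewrite -[_ * _](subKr w); apply: idealB => //; first by case: pQ.
      exact: sIQ.
    rewrite mulrC; move: Qc; rewrite es; apply: lincombZ => [a _|_ ->].
      by split=> //; apply: idealMr => //; case: pm.
    by rewrite mulr0; exact: ideal0.
have [g' gg'] := hm.2 _ nmg.
have hJ : ideal (fun x => I (g * x)).
  split=> [|a b|a b]; rewrite ?mulr0 ?mulrDr; first exact: ideal0.
  - exact: idealD.
  - by rewrite mulrCA; exact: idealMl.
have := generated_min hJ gI.
rewrite -es => /(_ _ Qz)/(idealMl g' hI); by rewrite mulrA [g' * g]mulrC gg'
  mul1r.
Qed.

End Regular.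

(** * p-independence *)

Section PSpan.
Variables (C : comPzRingType) (p : nat).
Implicit Types (K E I T : set C) (s : seq C).

(* The K-span of the p-monomials in the entries of s.                         *)
Fixpoint pspan K s : set C :=
  if s is b :: s' then
    [set x | exists2 k : nat -> C, (forall i, pspan K s' (k i))
      & x = \sum_(i < p) k i * b ^+ i]
  else K.

(* The p-monomials in the entries of s are linearly independent over K modulo *)
(* I.                                                                         *)
Fixpoint pfree K I s : Prop :=
  if s is b :: s' then
    pfree K I s' /\ forall k : nat -> C, (forall i, pspan K s' (k i)) ->
      I (\sum_(i < p) k i * b ^+ i) -> forall i, (i < p)%N -> I (k i)
  else True.

Definition pfree_set K I T :=
  forall s, uniq s -> (forall b, b \in s -> T b) -> pfree K I s.

Definition pspan_set K T : set C :=
  [set x | exists2 s, (forall b, b \in s -> T b) & pspan K s x].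

Lemma pspan_min K E s : subring E -> K `<=` E -> (forall b, b \in s -> E b) ->
  pspan K s `<=` E.
Proof.
move=> hE sK; elim: s => [//|b s IH] sE _ /= [k hk ->].
apply: subring_sum => // i _; apply: subringM => //.
  by apply: IH (hk i) => c cs; apply: sE; rewrite inE cs orbT.
by apply: subringX => //; apply: sE; exact: mem_head.
Qed.

Section Subring.
Variable K : set C.
Hypotheses (p_gt1 : (1 < p)%N) (hK : subring K) (powK : forall c, K (c ^+ p)).

Let p_gt0 : (0 < p)%N. Proof. exact: ltnW. Qed.

Lemma pspan_head s b : pspan K s `<=` pspan K (b :: s).
Proof.
move=> x hx; exists (fun i => if i is 0 then x else 0).
  have h0 : pspan K s 0.
    elim: s {hx} => [|c s IH]; first exact: subring0.
    by exists (fun=> 0) => //; rewrite big1 // => i _; rewrite mul0r.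
  by case.
rewrite (bigD1 (Ordinal p_gt0)) //= expr0 mulr1 big1 ?addr0 //.
by case=> -[|i] //= _ _; rewrite mul0r.
Qed.

Lemma sub_pspan s : K `<=` pspan K s.
Proof. by elim: s => [//|b s IH] x /IH; exact: pspan_head. Qed.

Lemma pspan_subring s : subring (pspan K s).
Proof.
elim: s => [//|b s IH].
have h0 : pspan K s 0 by exact: subring0.
have hB x y : pspan K (b :: s) x -> pspan K (b :: s) y ->
  pspan K (b :: s) (x - y).
  move=> [k hk ->] [l hl ->]; exists (fun i => k i - l i).
    by move=> i; exact: subringB IH (hk i) (hl i).
  by rewrite -sumrB; apply: eq_bigr => i _; rewrite mulrBl.
have hD x y : pspan K (b :: s) x -> pspan K (b :: s) y ->
  pspan K (b :: s) (x + y).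
  move=> hx hy; rewrite -[y]opprK -[- y]sub0r; apply: (hB) => //;
    apply: (hB) => //.
  exact: pspan_head h0.
split=> //; first by apply: pspan_head; exact: subring1.
have hM a x : pspan K s a -> pspan K (b :: s) x -> pspan K (b :: s) (a * x).
  move=> ha [k hk ->]; exists (fun i => a * k i).
    by move=> i; exact: subringM IH ha (hk i).
  by rewrite big_distrr /=; apply: eq_bigr => i _; rewrite mulrA.
have hb x : pspan K (b :: s) x -> pspan K (b :: s) (b * x).
  move=> [k hk ->].
  (* Multiplication by [b] shifts the coefficients; the top one wraps around to degree 0 with the
     factor [b ^+ p], which lies in [K]. *)
  exists (fun i => if i is j.+1 then k j else k p.-1 * b ^+ p).
    case=> [|i]; last exact: hk.
    by apply: subringM IH (hk _) _; exact: sub_pspan.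
  have ep : p.-1.+1 = p by rewrite prednK.
  have cast (F : nat -> C) : \sum_(i < p) F i = \sum_(i < p.-1.+1) F i by
    rewrite ep.
  rewrite big_distrr /= (cast (fun i => b * (k i * b ^+ i))).
  rewrite (cast (fun i =>
    (if i is j.+1 then k j else k p.-1 * b ^+ p) * b ^+ i)).
  rewrite big_ord_recr [RHS]big_ord_recl /= expr0 mulr1 addrC; congr (_ + _).
    by rewrite mulrCA -exprS ep.
  by apply: eq_bigr => i _; rewrite mulrCA /bump /= add1n -exprS.
move=> x _ hx [l hl ->]; rewrite big_distrr /=.
apply: (big_ind (pspan K (b :: s))) => [||i _];
  [exact: pspan_head h0 | exact: hD |].
rewrite mulrCA; apply: (hM _ _ (hl i)); elim: (i : nat) => [|j IHj].
  by rewrite expr0 mulr1.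
by rewrite exprS mulrCA; exact: hb.
Qed.

Lemma pspan_mem s b : b \in s -> pspan K s b.
Proof.
elim: s => [//|c s IH]; rewrite inE => /predU1P[<-|/IH]; last exact: pspan_head.
exists (fun i => (i == 1%N)%:R).
  by move=> i; apply: subring_nat; exact: pspan_subring.
rewrite (bigD1 (Ordinal p_gt1)) //= expr1 mul1r big1 ?addr0 //.
by move=> i /eqP ni; case: eqP => [ei|]; [case: ni;
  apply: val_inj | rewrite mul0r].
Qed.

Lemma pspanS s s' : {subset s <= s'} -> pspan K s `<=` pspan K s'.
Proof.
move=> ss; apply: pspan_min; first exact: pspan_subring.
  exact: sub_pspan.
by move=> b /ss; exact: pspan_mem.
Qed.

Lemma pspan_eq s s' : s =i s' -> pspan K s = pspan K s'.
Proof. by move=> e; apply/seteqP; split; apply: pspanS => b; rewrite e. Qed.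

Lemma pfree_cons_eq I b s s' : s =i s' -> pfree K I s' ->
  pfree K I (b :: s) -> pfree K I (b :: s').
Proof. by move=> /pspan_eq e fs' [_]; rewrite /= e. Qed.

(** The coefficients of the powers of [b] are themselves expansions in [a]; exchanging the two sums
    gives a relation in powers of [a] over the span of [b :: s]. *)
Lemma pfree_swap I a b s : ideal I ->
  pfree K I (a :: b :: s) -> pfree K I (b :: a :: s).
Proof.
move=> hI [[fs fb] fa]; split; first split=> // k hk.
  by apply: fa => i; exact: pspan_head.
move=> k hk hsum j lt_jp.
have /choice[l hl] : forall j', exists l : nat -> C,
    (forall i, pspan K s (l i)) /\ k j' = \sum_(i < p) l i * a ^+ i.
  by move=> j'; have [l] := hk j'; exists l.
have hl1 j' i : pspan K s (l j' i) by have [] := hl j'.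
have hl2 j' : k j' = \sum_(i < p) l j' i * a ^+ i by have [] := hl j'.
rewrite hl2; apply: ideal_sum => // i _; apply: idealMr => //.
apply: (fb (l ^~ i)) => //.
apply: (fa (fun i => \sum_(j < p) l j i * b ^+ j)) => //.
  by move=> i'; exists (l ^~ i').
move: hsum; congr I; under eq_bigr do rewrite hl2 big_distrl /=.
rewrite exchange_big /=; apply: eq_bigr => i' _; rewrite big_distrl /=.
by apply: eq_bigr => j' _; rewrite mulrAC.
Qed.

Lemma pfree_perm I s s' : ideal I -> perm_eq s s' -> pfree K I s ->
  pfree K I s'.
Proof.
move=> hI; elim: s' s => [//|b s' IH] s.
move=> peq; have : b \in s by rewrite (perm_mem peq) mem_head.
move=> /splitPr es; case: s / es peq => s1 s2 peq.
have peq' : perm_eq (s1 ++ s2) s'.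
  by move: peq; rewrite -cat1s perm_catCA /= perm_cons.
have front : pfree K I (s1 ++ b :: s2) -> pfree K I (b :: s1 ++ s2).
  elim: (s1) => [//|a t IHt] /= [/[dup] ft /IHt fbt fa].
  apply: pfree_swap => //; apply: (pfree_cons_eq (s := t ++ b :: s2)) => //.
  by move=> c; rewrite !(inE, mem_cat); case: eqP; rewrite ?orbT.
move=> /front /[dup] -[f12 _].
by apply: pfree_cons_eq; [exact: perm_mem | exact: IH f12].
Qed.

Lemma pspan_set_finite T s : 
  (forall b, b \in s -> pspan_set K T b) ->
  exists2 t, (forall b, b \in t -> T b) & forall b, b \in s -> pspan K t b.
Proof.
elim: s => [|b s IH] hs; first by exists [::].
have [t1 tT1 h1] := hs b (mem_head _ _).
have [t2 tT2 h2] := IH (fun c cs => hs c (mem_behead (s := b :: s) cs)).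
exists (t1 ++ t2) => [c|c].
  by rewrite mem_cat => /orP[/tT1|/tT2].
rewrite inE => /predU1P[->|/h2]; last by apply: pspanS => d;
  rewrite mem_cat orbC => ->.
by move: h1; apply: pspanS => d; rewrite mem_cat => ->.
Qed.

Lemma pspan_set_subring T : subring (pspan_set K T).
Proof.
have h s x y : (forall b, b \in s -> T b) -> pspan K s x -> pspan K s y ->
    pspan_set K T (x - y) /\ pspan_set K T (x * y).
  move=> sT hx hy; split; exists s => //; [apply: subringB|apply: subringM] =>
    //;
    exact: pspan_subring.
split; first by exists [::] => //; exact: subring1.
all: move=> x y hx hy; have [|t tT ht] := @pspan_set_finite T [:: x; y].
1,3: by move=> z; rewrite !inE => /orP[]/eqP->.
all: by have [] := h t x y tT (ht _ (mem_head _ _)) (ht _ (mem_last _ [:: _])).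
Qed.

Lemma sub_pspan_set T : K `<=` pspan_set K T.
Proof. by move=> x Kx; exists [::]. Qed.

Lemma pspan_set_mem T : T `<=` pspan_set K T.
Proof.
move=> b Tb; exists [:: b]; last by apply: pspan_mem; exact: mem_head.
by move=> c; rewrite inE => /eqP->.
Qed.

Lemma pspan_set_min T E : subring E -> K `<=` E -> T `<=` E ->
  pspan_set K T `<=` E.
Proof. by move=> hE sK sT x [s sT']; apply: pspan_min => // b /sT'/sT. Qed.

Lemma pspan_setS T T' : T `<=` T' -> pspan_set K T `<=` pspan_set K T'.
Proof. by move=> sT x [s hs hx]; exists s => // b /hs/sT. Qed.

End Subring.

Hypotheses (p_pr : prime p) (p0 : p%:R = 0 :> C).

Lemma exprDp (x y : C) : (x + y) ^+ p = x ^+ p + y ^+ p.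
Proof.
case: (p) p_pr p0 => [//|q] q_pr q0.
rewrite exprDn big_ord_recl big_ord_recr /= subn0 !expr0 mulr1 bin0 mulr1n.
rewrite /bump /= !add1n subnn expr0 mul1r binn mulr1n big1 ?add0r // => i _.
have /dvdnP[n ->] : (q.+1 %| 'C(q.+1, i.+1))%N.
  by apply: prime_dvd_bin => //=; exact: ltn_ord i.
by rewrite mulnC mulrnA -[_ *+ q.+1]mulr_natr q0 mulr0 mul0rn.
Qed.

End PSpan.

Section PthPowers.
Variables (p : nat) (C : comPzRingType).
Hypotheses (p_pr : prime p) (p0 : p%:R = 0 :> C).

Lemma exprBp (x y : C) : (x - y) ^+ p = x ^+ p - y ^+ p.
Proof. by apply/eqP; rewrite eq_sym subr_eq -exprDp // subrK. Qed.

Lemma pth_powers_subring : subring (@pth_powers p C).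
Proof.
split=> [|_ _ [x _ <-] [y _ <-]|_ _ [x _ <-] [y _ <-]].
- by exists 1; rewrite ?expr1n.
- by exists (x - y); rewrite ?exprBp.
- by exists (x * y); rewrite ?exprMn.
Qed.

Lemma pth_powersX (c : C) : pth_powers p (c ^+ p).
Proof. by exists c. Qed.

End PthPowers.

Section Morphism.
Variables (p : nat) (C D : comPzRingType) (f : {rmorphism C -> D}).
Implicit Types (K : set C) (L I : set D) (s : seq C).

Lemma pspan_map K L s x : (forall x, K x -> L (f x)) ->
  pspan p K s x -> pspan p L (map f s) (f x).
Proof.
move=> fK; elim: s x => [|b s IH] x /=; first exact: fK.
move=> [k hk ->]; exists (f \o k) => [i|]; first exact/IH/hk.
by rewrite rmorph_sum; apply: eq_bigr => i _; rewrite rmorphM rmorphXn.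
Qed.

Lemma pspan_map_inv K L s y : (forall y, L y -> exists2 x, K x & f x = y) ->
  pspan p L (map f s) y -> exists2 x, pspan p K s x & f x = y.
Proof.
move=> fK; elim: s y => [|b s IH] y /=; first exact: fK.
move=> [k hk ->].
have /choice[l hl] : forall i, exists x, pspan p K s x /\ f x = k i.
  by move=> i; have [x hx ex] := IH _ (hk i); exists x.
exists (\sum_(i < p) l i * b ^+ i); first by exists l => // i; have [] := hl i.
rewrite rmorph_sum; apply: eq_bigr => i _; rewrite rmorphM rmorphXn.
by have [_ ->] := hl i.
Qed.

Lemma pfree_comap K L I s : (forall x, K x -> L (f x)) ->
  pfree p L I (map f s) -> pfree p K (f @^-1` I) s.
Proof.
move=> fK; elim: s => [//|b s IH] /= [/IH fs fb]; split=> // k hk hI i lt_ip.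
apply: (fb (f \o k)) => // [j|]; first exact: pspan_map fK (hk j).
move: hI; congr I; rewrite rmorph_sum.
by apply: eq_bigr => j _; rewrite rmorphM rmorphXn.
Qed.

Lemma pfree_map K L I s : (forall y, L y -> exists2 x, K x & f x = y) ->
  pfree p K (f @^-1` I) s -> pfree p L I (map f s).
Proof.
move=> fK; elim: s => [//|b s IH] /= [/IH fs fb]; split=> // k hk hI i lt_ip.
have /choice[l hl] : forall i, exists x, pspan p K s x /\ f x = k i.
  by move=> j; have [x hx ex] := pspan_map_inv fK (hk j); exists x.
have fl j : f (l j) = k j by have [] := hl j.
rewrite -fl; apply: fb lt_ip => [j|]; first by have [] := hl j.
move: hI; rewrite /preimage /= rmorph_sum; congr I.
by apply: eq_bigr => j _; rewrite rmorphM rmorphXn fl.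
Qed.

Lemma pth_powers_map x : pth_powers p x -> pth_powers p (f x).
Proof. by move=> [c _ <-]; exists (f c); rewrite ?rmorphXn. Qed.

Lemma pth_powers_map_inv : (forall y, exists x, f x = y) ->
  forall y, pth_powers p y -> exists2 x, pth_powers p x & f x = y.
Proof.
move=> fsurj _ [d _ <-]; have [c <-] := fsurj d.
by exists (c ^+ p); [exact: pth_powersX | rewrite rmorphXn].
Qed.

Lemma preimage_ideal I : ideal I -> ideal (f @^-1` I).
Proof.
move=> hI; split=> [|x y|a x]; rewrite /preimage /=.
- by rewrite rmorph0; exact: ideal0.
- by rewrite rmorphD; exact: idealD.
- by rewrite rmorphM; exact: idealMl.
Qed.

Lemma preimage_prime I : prime_ideal I -> prime_ideal (f @^-1` I).
Proof.
move=> [hI I1 IM]; split; first exact: preimage_ideal.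
  by rewrite /preimage /= rmorph1.
by move=> x y; rewrite /preimage /= rmorphM; exact: IM.
Qed.

End Morphism.

(** * Lifting p-independence along a regular flag *)

Section RegularFree.
Variables (p : nat) (A : comPzRingType) (m : set A).
Hypotheses (p_pr : prime p) (p0 : p%:R = 0 :> A).
Hypotheses (hA : noetherian A) (hm : local_at m).
Implicit Types (I J : set A) (s ys : seq A).
Local Notation K := (@pth_powers p A).

Let p_gt0 : (0 < p)%N := prime_gt0 p_pr.
Let p_gt1 : (1 < p)%N := prime_gt1 p_pr.
Let hK : subring K := pth_powers_subring p_pr p0.
Let hspan s : subring (pspan p K s) :=
  pspan_subring p_gt1 hK (@pth_powersX p A) s.

(** Modulo [I] the quotients satisfy [w n = y * w n.+1], so the ideals [I + (w n)] increase. Once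
    they stabilize, [w n.+1 = c y * w n.+1] modulo [I], and [1 - c y] is outside [m]. *)
Lemma krull_intersection I y z : prime_ideal I -> m y -> ~ I y ->
  (forall n, exists w, I (z - y ^+ n * w)) -> I z.
Proof.
move=> pI my nIy /choice[w hw]; have iI := prime_ideal_ideal pI.
have step n : I (w n - y * w n.+1).
  apply: (primeMl pI (x := y ^+ n)); last exact: primeX.
  have -> : y ^+ n * (w n - y * w n.+1)
      = (z - y ^+ n.+1 * w n.+1) - (z - y ^+ n * w n).
    by rewrite exprSr; ring.
  exact: idealB.
have [n|n|n sub] := @noetherian_acc _ (fun n => lincomb setT I [:: w n]) hA.
- exact: lincomb_ideal.
- apply: lincomb_sub; [exact: lincomb_ideal | by move=> x;
    exact: lincomb_base |].
  by move=> v; rewrite inE => /eqP->; exists y.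
have [|c _ /= hc] := sub (w n.+1).
  by exists 1 => //=; rewrite mul1r subrr; exact: ideal0.
have Iw : I (w n.+1).
  apply: (primeMl pI (x := 1 - c * y)).
    have -> : (1 - c * y) * w n.+1
        = (w n.+1 - c * w n) + c * (w n - y * w n.+1).
      by ring.
    by apply: idealD => //; exact: idealMl.
  move=> /(local_prime_sub hm pI) h.
  have := prime1 hm.1; apply; apply: (ideal_subK _ h); first by case: hm.1.
  by apply: idealMl => //; case: hm.1.
by apply: (ideal_subK iI (hw n.+1)); exact: idealMl.
Qed.

(** Freeness puts the innermost coefficients, which are p-th powers [c ^+ p], into the prime
    [I + (y)]. Then [c = a y] modulo [I], and additivity of the Frobenius gives
    [c ^+ p = a ^+ p * y ^+ p] modulo [I]. *)
Lemma pspan_lift I y s z : prime_ideal I ->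
  prime_ideal (lincomb setT I [:: y]) -> pfree p K (lincomb setT I [:: y]) s ->
  pspan p K s z -> lincomb setT I [:: y] z ->
  exists2 w, pspan p K s w & I (z - y ^+ p * w).
Proof.
move=> pI pJ; have iI := prime_ideal_ideal pI.
elim: s z => [|b s IH] z /=.
  move=> _ [c _ <-] /(primeXE pJ)[a _ /= hc]; exists (a ^+ p).
    exact: pth_powersX.
  have -> : c ^+ p - y ^+ p * a ^+ p = (c - a * y) ^+ p.
    by rewrite exprBp // exprMn [y ^+ p * _]mulrC.
  by rewrite -(prednK p_gt0) exprS; exact: idealMr.
move=> [fs fb] [k hk ->] /(fb _ hk) hJ.
have /choice[l hl] : forall i, exists w, pspan p K s w /\
    ((i < p)%N -> I (k i - y ^+ p * w)).
  move=> i; case: (ltnP i p) => [lt_ip|_]; last first.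
    by exists 0; split=> //; exact: subring0 (hspan s).
  by have [w hw Iw] := IH _ fs (hk i) (hJ i lt_ip); exists w.
exists (\sum_(i < p) l i * b ^+ i); first by exists l => // i; have [] := hl i.
rewrite big_distrr /= -sumrB; apply: ideal_sum => // i _.
by rewrite mulrA -mulrBl; apply: idealMr => //; have [_] := hl i; apply.
Qed.

Lemma pfree_cons_lift I y s : prime_ideal I ->
  prime_ideal (lincomb setT I [:: y]) -> ~ I y -> m y ->
  pfree p K (lincomb setT I [:: y]) s -> pfree p K I (y :: s).
Proof.
move=> pI pJ nIy my; have iI := prime_ideal_ideal pI.
set J := lincomb setT I [:: y] => fJs.
have iJ : ideal J by exact: lincomb_ideal.
have sIJ : I `<=` J by move=> x Ix; exact: lincomb_base.
have Jy : J y by exists 1 => //=; rewrite mul1r subrr; exact: ideal0.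
split.
  elim: s fJs => [//|b s IH] /= [fs fb]; split; first exact: IH.
  move=> k hk hsum i lt_ip; apply: (krull_intersection pI my nIy) => n.
  (* The coefficients of a relation modulo [I] lie in [J], hence are [y^p] times elements of the
     span. These quotients satisfy the same relation, since [y] is outside [I], and the division can
     be repeated [n] times. *)
  have [l [_ _ kl]] : exists l : nat -> A, [/\ forall i, pspan p K s (l i),
      I (\sum_(i < p) l i * b ^+ i)
    & forall i, (i < p)%N -> I (k i - y ^+ p ^+ n * l i)].
    elim: n => [|n [l [hl Il kl]]].
      by exists k; split=> // j _; rewrite mul1r subrr; exact: ideal0.
    have Jl := fb _ hl (sIJ _ Il).
    have /choice[l' hl'] : forall i, exists w, pspan p K s w /\
        ((i < p)%N -> I (l i - y ^+ p * w)).
      move=> j; case: (ltnP j p) => [lt_jp|_]; last first.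
        by exists 0; split=> //; exact: subring0 (hspan s).
      by have [w hw Iw] := pspan_lift pI pJ fs (hl j) (Jl j lt_jp); exists w.
    have Il' j : (j < p)%N -> I (l j - y ^+ p * l' j) by have [_] := hl' j.
    exists l'; split=> [j|| j lt_jp]; first by have [] := hl' j.
      apply: (primeMl pI (x := y ^+ p)); last exact: primeX.
      rewrite -[_ * _](subKr (\sum_(j < p) l j * b ^+ j)); apply: idealB => //.
      rewrite big_distrr /= -sumrB; apply: ideal_sum => // j _.
      by rewrite mulrA -mulrBl; apply: idealMr => //; exact: Il'.
    have -> : k j - y ^+ p ^+ n.+1 * l' j
        = (k j - y ^+ p ^+ n * l j) + y ^+ p ^+ n * (l j - y ^+ p * l' j).
      by rewrite exprSr; ring.
    apply: idealD => //; first exact: kl.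
    by apply: idealMl => //; exact: Il'.
  exists (y ^+ p.-1 ^+ n * l i).
  by rewrite mulrA -exprMn -exprS prednK //; exact: kl.
move=> k hk hsum i lt_ip; apply: (krull_intersection pI my nIy) => n.
(* Since k_0 = y^p l_0 modulo I, the relation can be divided by y, and then   *)
(* has the coefficients k_1, ..., k_(p-1), l_0.                               *)
have main N : forall k : nat -> A, (forall i, pspan p K s (k i)) ->
    I (\sum_(i < p) k i * y ^+ i) ->
    forall i, (i < p)%N -> exists w, I (k i - y ^+ (N - i) * w).
  elim: N => [|N IH] {hk hsum lt_ip i n}k hk hsum i lt_ip.
    by exists (k i); rewrite mul1r subrr; exact: ideal0.
  have cast (F : nat -> A) : \sum_(i < p) F i = F 0 + \sum_(i < p.-1) F i.+1.
    by rewrite -[in LHS](prednK p_gt0) big_ord_recl.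
  have Jk0 : J (k 0%N).
    move: (sIJ _ hsum); rewrite (cast (fun i => k i * y ^+ i)) expr0 mulr1 => h.
    rewrite -(addrK (\sum_(i < p.-1) k i.+1 * y ^+ i.+1) (k 0%N)).
    apply: idealB => //; apply: ideal_sum => // j _; rewrite exprS mulrCA.
    exact: idealMr.
  have [w hw Iw] := pspan_lift pI pJ fJs (hk 0%N) Jk0.
  pose l j := if (j < p.-1)%N then k j.+1 else w.
  have hl j : pspan p K s (l j) by rewrite /l; case: ifP.
  have Il : I (\sum_(j < p) l j * y ^+ j).
    apply: (primeMl pI (x := y)) => //.
    have -> : y * (\sum_(j < p) l j * y ^+ j)
        = \sum_(j < p) k j * y ^+ j - (k 0%N - y ^+ p * w).
      rewrite (cast (fun i => k i * y ^+ i)) -[in LHS](prednK p_gt0)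
        big_ord_recr /=.
      rewrite {2}/l ltnn mulrDr mulrCA -exprS prednK // expr0 mulr1.
      rewrite [w * _]mulrC opprB addrC [k 0%N + _]addrC addrA addrAC addrK
        addrC.
      congr (_ + _); rewrite big_distrr /=; apply: eq_bigr => j _.
      by rewrite mulrCA -exprS /l ltn_ord.
    exact: idealB.
  case: i lt_ip => [|i] lt_ip.
    (* Here [k 0] is divisible by [y] to the power [p + (N - p.-1)]. With truncated subtraction this
       is at least [N.+1] in all cases, and the surplus goes into the witness. *)
    have [v Iv] := IH l hl Il p.-1 (ltac:(by rewrite prednK)).
    exists (y ^+ (p + (N - p.-1) - N.+1) * v); rewrite mulrA -exprD subn0.
    have -> : (N.+1 + (p + (N - p.-1) - N.+1) = p + (N - p.-1))%N by lia.
    rewrite exprD -mulrA; move: Iv; rewrite {1}/l ltnn => Iv.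
    have -> : k 0%N - y ^+ p * (y ^+ (N - p.-1) * v)
        = (k 0%N - y ^+ p * w) + y ^+ p * (w - y ^+ (N - p.-1) * v) by ring.
    by apply: idealD => //; exact: idealMl.
  have [v Iv] := IH l hl Il i (ltnW lt_ip); exists v; rewrite subSS.
  by move: Iv; rewrite {1}/l; case: ifP => // /negP[]; lia.
have [w] := main (n + i)%N k hk hsum i lt_ip.
by rewrite addnK => Iw; exists w.
Qed.

Lemma regular_flag_prime I ys : regular_flag m I ys -> prime_ideal I.
Proof. by case: ys => [e|y ys []//]; rewrite e; case: hm. Qed.

Lemma pfree_regular_flag I ys s : regular_flag m I ys -> pfree p K m s ->
  pfree p K I (ys ++ s).
Proof.
move=> + fs; elim: ys I => [|y ys IH] I; first by move=> e; rewrite e.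
move=> [pI nIy my flag]; apply: pfree_cons_lift => //; last exact: IH.
exact: regular_flag_prime flag.
Qed.

End RegularFree.

(** * p-bases of fields and polynomial rings *)

Section PrimeQuotient.
Variables (A : comNzRingType) (I : prime_idealr A).

(** A copy of the quotient, to be equipped with a unit predicate and an inverse, both chosen
    classically, as [idomainType] demands them. *)
Definition quotient_domain : Type := {ideal_quot I}.

HB.instance Definition _ := GRing.ComNzRing.on quotient_domain.

Definition quotient_unit (x : quotient_domain) : bool :=
  `[< exists y, y * x = 1 >].

Definition quotient_inv (x : quotient_domain) : quotient_domain :=
  if pselect (exists y, y * x = 1) is left h then projT1 (cid h) else x.

Lemma quotient_mulV : {in quotient_unit, left_inverse 1 quotient_inv *%R}.
Proof.
move=> x; rewrite unfold_in /quotient_unit /quotient_inv.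
by case: pselect => [h _|h /asboolP//]; case: cid.
Qed.

Lemma quotient_unitP x y : y * x = 1 -> quotient_unit x.
Proof. by move=> yx1; apply/asboolP; exists y. Qed.

Lemma quotient_inv_out : {in [predC quotient_unit], quotient_inv =1 id}.
Proof.
move=> x; rewrite !inE unfold_in /quotient_unit /quotient_inv => /asboolP nx.
by case: pselect.
Qed.

HB.instance Definition _ := GRing.ComNzRing_hasMulInverse.Build quotient_domain
  quotient_mulV quotient_unitP quotient_inv_out.

HB.instance Definition _ := GRing.ComUnitRing_isIntegral.Build quotient_domain
  (@Quotient.rquot_IdomainAxiom A I).

End PrimeQuotient.

(** Gives access to polynomial divisibility over an integral domain. A prime ideal forces [1 != 0],
    so [A] can be repacked as a nonzero ring and [P] as a boolean ideal. *)
Lemma prime_quotient (A : comPzRingType) (P : set A) : prime_ideal P ->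
  exists (D : idomainType) (f : {rmorphism A -> D}),
    (forall d, exists a, f a = d) /\ f @^-1` [set 0] = P.
Proof.
move=> pP; have iP := prime_ideal_ideal pP.
have nz : (1 : A) != 0.
  by apply/eqP => e; apply: (prime1 pP); rewrite e; exact: ideal0.
pose A' : comNzRingType :=
  HB.pack_for comNzRingType A (GRing.PzSemiRing_isNonZero.Build A nz).
pose b (x : A') : bool := `[< P x >].
have bid : idealr_closed b.
  split=> [||a x y]; rewrite ?unfold_in.
  - by apply/asboolP; exact: ideal0.
  - by apply/asboolP; exact: prime1.
  - move=> /asboolP Px /asboolP Py; apply/asboolP; apply: idealD => //.
    exact: idealMl.
have bpr : prime_idealr_closed b.
  move=> x y; rewrite !unfold_in => /asboolP; case: pP => _ _ /[apply].
  by case=> /asboolP->; rewrite ?orbT.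
pose I : prime_idealr A' := HB.pack_for (prime_idealr A') b
  (isIdealr.Build A' b bid) (isPrimeIdealrClosed.Build A' b bpr).
pose D : idomainType := quotient_domain I.
pose f : {rmorphism A' -> {ideal_quot I}} := (\pi_({ideal_quot I}))%qT.
exists D, f; split=> [d|]; first by exists (repr d); exact: reprK.
have fE x : (f x = 0) <-> P x.
  rewrite -(rmorph0 f); split=> [e|Px].
    have /asboolP : (x - 0 \in I) by rewrite Quotient.idealrBE; apply/eqP.
    by rewrite subr0.
  by apply/eqP; rewrite -Quotient.idealrBE subr0 unfold_in; apply/asboolP.
by apply/seteqP; split=> x /fE.
Qed.

Lemma coef_XsubC_exp (R : comNzRingType) (u : R) n :
  (('X - u%:P) ^+ n.+1)`_n = - u *+ n.+1.
Proof.
elim: n => [|n IH]; first by rewrite expr1 coefB coefX coefC /= sub0r.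
rewrite exprS mulrBl coefB coefXM coefCM /= IH.
have := monicP (monic_exp n.+1 (monicXsubC u)).
rewrite /lead_coef size_exp_XsubC /= => ->.
by rewrite mulr1 [RHS]mulrSr.
Qed.

(** * The exchange property of p-independence *)

Section Exchange.
Variables (p : nat) (D : idomainType) (E : set D) (u : D).
Hypotheses (p_pr : prime p) (p0 : p%:R = 0 :> D).
Hypotheses (hE : subring E) (powE : forall c, E (c ^+ p)).

Definition vanishing (q : {poly D}) := (forall i, E q`_i) /\ root q u.

(** Divisibility [%|] over a domain is up to nonzero scalars. Cross-multiplying by the leading
    coefficients cancels the top term of [g] without leaving [E], so the degree drops. *)
Lemma minimal_vanishing_dvd f g : vanishing f -> vanishing g ->
  (forall q, vanishing q -> q != 0 -> (size f <= size q)%N) -> f != 0 -> f %| g.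
Proof.
move=> [Ef fu] + minf f0; have [n] := ubnP (size g).
elim: n g => [//|n IH] g; rewrite ltnS => le_gn [Eg gu].
have [->|g0] := eqVneq g 0; first by rewrite dvdp0.
have le_fg := minf g (conj Eg gu) g0.
have lf0 : lead_coef f != 0 by rewrite lead_coef_eq0.
rewrite -(dvdpZr _ _ lf0); set h := 'X^(size g - size f) * f.
have hE' j : h`_j =
    if (j < size g - size f)%N then 0 else f`_(j - (size g - size f)).
  exact: coefXnM.
have g_gt0 : (0 < size g)%N by rewrite size_poly_gt0.
have f_gt0 : (0 < size f)%N by rewrite size_poly_gt0.
pose r := lead_coef f *: g - lead_coef g *: h.
have fh : f %| lead_coef g *: h by rewrite dvdpZr ?lead_coef_eq0 // dvdp_mull.
rewrite -(dvdp_subl _ fh); apply: IH.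
  apply: (leq_trans (n := size g)) => //; rewrite -(prednK g_gt0) ltnS.
  apply/leq_sizeP => j le_j; rewrite coefB !coefZ hE' /lead_coef.
  have [lt_j|ge_j] := ltnP j (size g); last first.
    have arith a b : (a <= b <= j)%N ->
      (a <= j - (b - a))%N /\ ~~ (j < b - a)%N.
      by lia.
    have [|le1 le2] := arith (size f) (size g); first by rewrite le_fg.
    rewrite ifN // [g`_j]nth_default // [f`_(j - _)]nth_default //.
    by rewrite !mulr0 subrr.
  have arith a b : (0 < a <= b)%N -> (b.-1 <= j < b)%N ->
    [/\ j = b.-1, (j - (b - a) = a.-1)%N & ~~ (j < b - a)%N] by move=> *;
      split; lia.
  have [||ej ej' le2] := arith (size f) (size g);
    [by rewrite f_gt0 | by rewrite le_j|].
  by rewrite ifN // ej' ej mulrC subrr.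
split=> [j|].
  rewrite /r coefB !coefZ hE'; apply: subringB => //; apply: subringM => //.
  - exact: Ef.
  - exact: Eg.
  - by case: ifP => // _; exact: subring0.
by rewrite /root /h hornerD hornerN !hornerZ hornerM (rootP fu) (rootP gu)
  !mulr0 subrr.
Qed.

(** A nonzero [f] over [E] of least degree vanishing at [u] divides [X^p - u^p = (X - u)^p], so it
    is proportional to a power of [X - u] of degree below [p]. Its two top coefficients then express
    [u] as a fraction over [E]. *)
Lemma exchange (k : nat -> D) i0 : (forall i, E (k i)) ->
  \sum_(i < p) k i * u ^+ i = 0 -> (i0 < p)%N -> k i0 != 0 ->
  exists w, [/\ w != 0, E w & E (w * u)].
Proof.
move=> Ek ksum lt_i0 ki0.
have p_gt0 := prime_gt0 p_pr.
pose q := \poly_(i < p) k i.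
have q0 : q != 0.
  by apply: contra_neq ki0 => q0; rewrite -[0](coef0 _ i0) -q0 coef_poly lt_i0.
have vq : vanishing q.
  split=> [i|]; first by rewrite coef_poly; case: ifP => // _; exact: subring0.
  by rewrite /root horner_poly ksum.
have [f [vf f0 le_fp minf]] : exists f, [/\ vanishing f, f != 0, (size f <= p)%N
    & forall q, vanishing q -> q != 0 -> (size f <= size q)%N].
  have exn : exists n, `[< exists q, [/\ vanishing q, q != 0 & size q = n] >].
    by exists (size q); apply/asboolP; exists q.
  case: (ex_minnP exn) => n /asboolP[f [vf f0 sf]] minn.
  have minf g : vanishing g -> g != 0 -> (size f <= size g)%N.
    by move=> vg g0; rewrite sf; apply: minn; apply/asboolP; exists g.
  exists f; split=> //; apply: leq_trans (minf _ vq q0) _; exact: size_poly.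
have pp0 : p%:R = 0 :> {poly D} by rewrite -polyC_natr p0.
have vXp : vanishing (('X - u%:P) ^+ p).
  split=> [i|]; last by rewrite /root horner_exp hornerXsubC subrr expr0n
    gtn_eqF // eqxx.
  rewrite exprBp // -polyC_exp coefB coefXn coefC; apply: subringB => //.
    exact: subring_nat.
  by case: ifP => // _; exact: subring0.
have /dvdp_exp_XsubCP[n le_np /eqpP[[c d] /= /andP[c0 d0] efc]] :=
  minimal_vanishing_dvd vf vXp minf f0.
have sf : size f = n.+1.
  by rewrite -(size_scale _ c0) efc size_scale // size_exp_XsubC.
case: n le_np efc sf => [|n] le_np efc sf.
  have [_ /eqP fu] := vf; have /size_poly1P[a a0 ef] : size f == 1%N by
    apply/eqP.
  by move: fu a0; rewrite ef hornerC => ->; rewrite eqxx.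
have lg : (('X - u%:P) ^+ n.+1)`_n.+1 = 1.
  by have := monicP (monic_exp n.+1 (monicXsubC u));
    rewrite /lead_coef size_exp_XsubC.
have ef1 : c * f`_n.+1 = d by rewrite -coefZ efc coefZ lg mulr1.
have ef2 : c * f`_n = d * (- u *+ n.+1) by rewrite -coefZ efc coefZ
  coef_XsubC_exp.
have [Ef _] := vf.
have wu : f`_n.+1 *+ n.+1 * u = - f`_n.
  apply: (mulfI c0); rewrite mulrN ef2 -ef1 -mulr_natr mulNrn mulrN opprK.
  by rewrite -[u *+ _]mulr_natr; ring.
exists (f`_n.+1 *+ n.+1); split; last first.
- by rewrite wu; exact: subringN.
- by rewrite -mulr_natr; apply: subringM => //; exact: subring_nat.
(* The bound [size f <= p] gives [n.+1 < p], so [n.+1] is nonzero in [D]. *)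
rewrite -mulr_natr mulf_neq0 //.
  by apply: contra_neq d0 => f0'; rewrite -ef1 f0' mulr0.
have pD : p \in [pchar D] by rewrite inE p_pr p0 eqxx.
rewrite -(dvdn_pcharf pD); apply/negP => /dvdn_leq.
by move: le_fp; rewrite sf ltnNge => /negP h /(_ isT).
Qed.

End Exchange.

Lemma exchange_mod (p : nat) (A : comPzRingType) (P E : set A) (u : A)
    (k : nat -> A) i0 :
  prime p -> p%:R = 0 :> A -> prime_ideal P ->
  subring E -> (forall c, E (c ^+ p)) -> (forall i, E (k i)) ->
  P (\sum_(i < p) k i * u ^+ i) -> (i0 < p)%N -> ~ P (k i0) ->
  exists w e, [/\ E w, ~ P w, E e & P (w * u - e)].
Proof.
move=> p_pr p0 pP hE powE Ek Psum lt_i0 nPk.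
have [D [f [fsurj fP]]] := prime_quotient pP.
have fPE x : (f x = 0) = P x by rewrite -fP.
have [|||||||w' [w0 [w Ew ew] [e Ee fe]]] := @exchange p D (f @` E) (f u) p_pr
  _ _ _ (f \o k) i0.
- by rewrite -(rmorph_nat f) p0 rmorph0.
- split=> [|_ _ [x Ex <-] [y Ey <-]|_ _ [x Ex <-] [y Ey <-]].
  + by exists 1; [exact: subring1 | rewrite rmorph1].
  + by exists (x - y); [exact: subringB | rewrite rmorphB].
  + by exists (x * y); [exact: subringM | rewrite rmorphM].
- by move=> d; have [c <-] := fsurj d; exists (c ^+ p); rewrite ?rmorphXn.
- by move=> i; exists (k i).
- move: Psum; rewrite -fPE rmorph_sum => fsum; rewrite -[RHS]fsum.
  by apply: eq_bigr => i _; rewrite rmorphM rmorphXn.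
- by [].
- by apply/eqP; rewrite /= fPE.
exists w, e; split=> //; first by rewrite -fPE ew; apply/eqP.
by rewrite -fPE rmorphB rmorphM ew fe subrr.
Qed.

Section PIndependence.
Variables (p : nat) (A : comPzRingType).
Hypotheses (p_pr : prime p) (p0 : p%:R = 0 :> A).
Local Notation K := (@pth_powers p A).

Let p_gt1 : (1 < p)%N := prime_gt1 p_pr.
Let hK : subring K := pth_powers_subring p_pr p0.
Let powK c : K (c ^+ p) := pth_powersX p c.

(** A list violating independence must contain [u]; moved to the front, [u] satisfies a nontrivial
    relation of degree below [p] over the span of the others. *)
Lemma pfree_set_exchange P T u : prime_ideal P -> pfree_set p K P T ->
  ~ pfree_set p K P (u |` T) ->
  exists w e, [/\ ~ P w, pspan_set p K T e & P (w ^+ p * u - e)].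
Proof.
move=> pP fT nf; have iP := prime_ideal_ideal pP.
apply: contrapT => nex; apply: nf => s us sT.
have [su|nsu] := boolP (u \in s); last first.
  apply: fT => // b bs; case: (sT b bs) => // eb.
  by move: nsu; rewrite -eb bs.
set t := rem u s; have tT b : b \in t -> T b.
  rewrite /t mem_rem_uniq // inE => /andP[/eqP nbu bs].
  by case: (sT b bs).
have ft : pfree p K P t by apply: fT => //; exact: rem_uniq.
have hEt : subring (pspan p K t) by exact: pspan_subring.
apply: (pfree_perm p_gt1 hK powK iP (s := u :: t)).
  by rewrite perm_sym; exact: perm_to_rem.
split=> // k hk Pk i lt_ip; apply: contrapT => nPk; apply: nex.
have powE c : pspan p K t (c ^+ p) by exact: sub_pspan.
have [w [e [Ew nPw Ee Pwe]]] := exchange_mod p_pr p0 pP hEt powE hk Pk lt_ip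
  nPk.
(* The factor [w ^+ p.-1] makes the multiplier of [u] a p-th power, which lies in every span over
   [K]. *)
exists w, (w ^+ p.-1 * e); split=> //.
  by exists t => //; apply: subringM => //; exact: subringX.
have -> : w ^+ p * u - w ^+ p.-1 * e = w ^+ p.-1 * (w * u - e).
  by rewrite -{1}(prednK (prime_gt0 p_pr)) exprSr; ring.
exact: idealMl.
Qed.

End PIndependence.

Lemma total_on_finite (T : eqType) (F : set (set T)) (s : seq T) :
  total_on F subset -> (forall b, b \in s -> (\bigcup_(X in F) X) b) ->
  s = [::] \/ exists2 X, F X & forall b, b \in s -> X b.
Proof.
move=> Ftot; elim: s => [|b s IH] hs; first by left.
right; have [X FX Xb] := hs b (mem_head _ _).
have [->|[Y FY sY]] := IH (fun c cs => hs c (mem_behead (s := b :: s) cs)).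
  by exists X => // c; rewrite inE => /eqP->.
have [sXY|sYX] := Ftot _ _ FX FY.
  by exists Y => // c; rewrite inE => /predU1P[->|/sY//]; exact: sXY.
by exists X => // c; rewrite inE => /predU1P[->//|/sY/sYX].
Qed.

Definition p_basis (p : nat) (A : comPzRingType) (B : set A) :=
  pfree_set p (@pth_powers p A) [set 0] B /\
  forall x, pspan_set p (@pth_powers p A) B x.

(** Zorn's lemma gives a maximal p-independent set, and by exchange an element outside its span
    could still be added. *)
Lemma field_p_basis (p : nat) (k : fieldType) : prime p -> p%:R = 0 :> k ->
  exists B : set k, p_basis p B.
Proof.
move=> p_pr p0; set K := @pth_powers p k.
have p_gt1 := prime_gt1 p_pr; have hK := pth_powers_subring p_pr p0.
have pr0 : prime_ideal [set (0 : k)].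
  split; [exact: zero_ideal | by move=> /eqP; rewrite oner_eq0 |].
  by move=> x y /eqP; rewrite mulf_eq0 => /orP[]/eqP->; [left|right].
have [F sF Ftot s us sU|B [fB maxB]] := @Zorn_bigcup k (pfree_set p K [set 0]).
  have [->//|[X FX sX]] := total_on_finite Ftot sU.
  exact: sF FX s us sX.
exists B; split=> // x; apply: contrapT => nx.
have sB := @pspan_set_mem _ p K p_gt1 hK (@pth_powersX p k) B.
have hS := pspan_set_subring p_gt1 hK (@pth_powersX p k) B.
have [|w [e [nw he]]] := @pfree_set_exchange p k p_pr p0 _ B x pr0 fB.
  apply: maxB; split; first by move=> y By; right.
  by move=> /(_ x (or_introl erefl))/sB.
move=> /eqP; rewrite subr_eq0 => /eqP ewx; apply: nx.
have -> : x = (w^-1) ^+ p * e.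
  by rewrite -ewx mulrA -exprMn mulVf ?expr1n ?mul1r //; apply/eqP.
by apply: subringM => //; apply: sub_pspan_set; exact: pth_powersX.
Qed.

Section PolyPBasis.
Variables (p : nat) (R : comNzRingType) (B : set R).
Hypotheses (p_pr : prime p) (p0 : p%:R = 0 :> R) (hB : p_basis p B).
Local Notation K := (@pth_powers p R).
Local Notation KX := (@pth_powers p {poly R}).

Let p_gt1 : (1 < p)%N := prime_gt1 p_pr.
Let p_gt0 : (0 < p)%N := prime_gt0 p_pr.
Let hK : subring K := pth_powers_subring p_pr p0.

Lemma poly_natr0 : p%:R = 0 :> {poly R}.
Proof. by rewrite -polyC_natr p0. Qed.

Let pX0 := poly_natr0.
Let hKX : subring KX := pth_powers_subring p_pr pX0.

Lemma coef_exp_p (g : {poly R}) j :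
  (g ^+ p)`_j = if (p %| j)%N then g`_(j %/ p) ^+ p else 0.
Proof.
have exp0p (S : nzRingType) : 0 ^+ p = 0 :> S by rewrite expr0n gtn_eqF.
elim/poly_ind: g j => [|g c IH] j.
  by rewrite exp0p !coef0 exp0p; case: ifP.
rewrite exprDp // exprMn -polyC_exp coefD coefMXn coefC IH.
have [->|j0] := eqVneq j 0%N.
  by rewrite p_gt0 add0r dvdn0 div0n coefD coefMX coefC /= add0r.
rewrite addr0; have [lt_jp|le_pj] := ltnP j p.
  by rewrite gtnNdvd // lt0n.
rewrite dvdn_subl //; case: ifP => // /dvdnP[q ej].
case: q ej => [|q] ej; first by rewrite ej eqxx in j0.
have -> : (j %/ p)%N = q.+1 by rewrite ej mulnK.
have -> : ((j - p) %/ p)%N = q by rewrite ej mulSn addKn mulnK.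
by rewrite coefD coefMX coefC /= addr0.
Qed.

(** A p-th power of a polynomial lives in degrees divisible by [p], with p-th powers as
    coefficients, and constants do not move degrees. *)
Lemma coef_pspan_polyC s z : pspan p KX (map polyC s) z ->
  forall j, pspan p K s z`_j /\ (~~ (p %| j)%N -> z`_j = 0).
Proof.
elim: s z => [|b s IH] z /=.
  move=> [g _ <-] j; rewrite coef_exp_p; case: ifP => _; split=> //.
    exact: pth_powersX.
  exact: subring0 hK.
move=> [k hk ->] j.
have eqz : (\sum_(i < p) k i * (b%:P) ^+ i)`_j = \sum_(i < p) (k i)`_j * b ^+ i.
  by rewrite coef_sum; apply: eq_bigr => i _; rewrite -polyC_exp coefMC.
rewrite eqz; split; first by exists (fun i => (k i)`_j) => // i;
  have [] := IH _ (hk i) j.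
move=> nj; apply: big1 => i _; have [_ ->//] := IH _ (hk i) j.
by rewrite mul0r.
Qed.

Lemma pfree_polyC s : pfree p K [set 0] s -> pfree p KX [set 0] (map polyC s).
Proof.
elim: s => [//|b s IH] /= [/IH fs fb]; split=> // k hk ksum i lt_ip.
apply/polyP => j; rewrite coef0.
apply: (fb (fun i => (k i)`_j)) => // [i'|].
  by have [] := coef_pspan_polyC (hk i') j.
have := congr1 (fun f : {poly R} => f`_j) ksum.
rewrite coef0 coef_sum => e; rewrite /= -[RHS]e.
by apply: eq_bigr => i' _; rewrite -polyC_exp coefMC.
Qed.

(** The terms [k i * 'X^i] have degrees in distinct residue classes modulo [p], so they cannot
    cancel. *)
Lemma pfree_X s : pfree p K [set 0] s -> pfree p KX [set 0] ('X :: map polyC s).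
Proof.
move=> /pfree_polyC fs; split=> // k hk ksum i lt_ip.
apply/polyP => j; rewrite coef0.
have [/dvdnP[q ej]|] := boolP (p %| j)%N; last by have [_] :=
  coef_pspan_polyC (hk i) j; apply.
have := congr1 (fun f : {poly R} => f`_(j + i)) ksum.
rewrite coef0 coef_sum (bigD1 (Ordinal lt_ip)) //= coefMXn ifN ?addnK;
  last by lia.
rewrite big1 ?addr0 // => i' /eqP ni'; rewrite coefMXn; case: ltnP => // le_i'.
have [_ ->//] := coef_pspan_polyC (hk i') (j + i - i').
apply/negP => /dvdnP[r er]; apply: ni'; apply: val_inj => /=.
have lt_i'p := ltn_ord i'.
have e : (j + i = i' + r * p)%N by rewrite -er subnKC.
move: e; rewrite ej [(i' + _)%N]addnC => /(congr1 (modn^~ p)).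
by rewrite !modnMDl !modn_small.
Qed.

Lemma poly_p_basis : p_basis p ('X |` (polyC @` B)).
Proof.
have [fB sB] := hB; split.
  have fC s : uniq s -> (forall f, f \in s -> (polyC @` B) f) ->
      exists2 t, s = map polyC t & pfree p K [set 0] t.
    move=> us sC; have es : s = map polyC (map (fun f : {poly R} => f`_0) s).
      rewrite -map_comp -[LHS]map_id; apply/eq_in_map => f /sC[c _ <-] /=.
      by rewrite coefC.
    exists (map (fun f : {poly R} => f`_0) s) => //; apply: fB.
      by move: us; rewrite {1}es; exact: map_uniq.
    by move=> _ /mapP[f /sC[c Bc <-] ->]; rewrite coefC.
  move=> s us sBX; have [Xs|nXs] := boolP ('X \in s).
    have [||t et ft] := fC (rem 'X s); first exact: rem_uniq.
      by move=> f; rewrite mem_rem_uniq // inE => /andP[/eqP nfX /sBX[]].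
    apply: (pfree_perm p_gt1 hKX (@pth_powersX p _) (zero_ideal _)
      (s := 'X :: rem 'X s)); first by rewrite perm_sym; exact: perm_to_rem.
    by rewrite et; exact: pfree_X.
  have [||t -> /pfree_polyC//] := fC s => // f fs; have [ef|//] := sBX f fs.
  by move: nXs; rewrite -ef fs.
have hS := pspan_set_subring p_gt1 hKX (@pth_powersX p _) ('X |` (polyC @` B)).
elim/poly_ind => [|f c IH]; first exact: subring0.
apply: subringD => //.
  apply: subringM => //; apply: pspan_set_mem => //; first exact: pth_powersX.
  by left.
have [s sBs hc] := sB c; exists (map polyC s).
  by move=> _ /mapP[b bs ->]; right; exists b => //; exact: sBs.
exact: (pspan_map (@pth_powers_map p _ _ (@polyC R)) hc).
Qed.

End PolyPBasis.

(** * Noetherian polynomial rings and presentations *)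

Section HilbertBasis.
Variable R : comNzRingType.
Hypothesis hR : noetherian R.
Variable I : set {poly R}.
Hypothesis hI : ideal I.

Definition leading n : set R :=
  [set a | exists f, [/\ I f, (size f <= n.+1)%N & f`_n = a]].

Lemma leading_ideal n : ideal (leading n).
Proof.
split=> [|_ _ [f [If sf <-]] [g [Ig sg <-]]|a _ [f [If sf <-]]].
- by exists 0; rewrite size_poly0 coef0; split=> //; exact: ideal0.
- exists (f + g); rewrite coefD; split=> //; first exact: idealD.
  by rewrite (leq_trans (size_polyD _ _)) // geq_max sf.
- exists (a%:P * f); rewrite coefCM; split=> //; first exact: idealMl.
  by rewrite mul_polyC (leq_trans (size_scale_leq _ _)).
Qed.

Lemma leadingS n : leading n `<=` leading n.+1.
Proof.
move=> _ [f [If sf <-]]; exists ('X * f); rewrite coefXM; split=> //.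
  exact: idealMl.
by rewrite mulrC; apply: leq_trans (size_polyMleq _ _) _;
  rewrite size_polyX addn2.
Qed.

Lemma leading_mono n m : (n <= m)%N -> leading n `<=` leading m.
Proof.
by move=> /subnK<-; elim: (m - n)%N => [//|i IH] x /IH; exact: leadingS.
Qed.

Lemma size_sub_leading (f g : {poly R}) n : (size f <= n.+1)%N ->
  (size g <= n.+1)%N -> f`_n = g`_n -> (size (f - g)%R <= n)%N.
Proof.
move=> /leq_sizeP sf /leq_sizeP sg e; apply/leq_sizeP => j le_nj; rewrite coefB.
have [<-|ne] := eqVneq n j; first by rewrite e subrr.
by rewrite sf ?sg ?subrr // ltn_neqAle ne le_nj.
Qed.

Lemma low_degree_generated n : exists2 s : seq {poly R},
  (forall f, f \in s -> I f) &
  forall f, I f -> (size f <= n)%N -> generated s f.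
Proof.
elim: n => [|n [s sI IH]].
  exists [::] => // f _; rewrite leqn0 size_poly_eq0 => /eqP->.
  exact: ideal0 (generated_ideal _).
have [t et] := (noetherianE R).1 hR _ (leading_ideal n).
have [F FI hF] : exists2 F : seq {poly R}, (forall f, f \in F -> I f) &
    forall a, a \in t -> exists f, [/\ f \in F, (size f <= n.+1)%N & f`_n = a].
  have : forall a, a \in t -> leading n a by rewrite et => a;
    exact: generated_mem.
  elim: {et} t => [_|a t IHt ht]; first by exists [::].
  have [F FI hF] := IHt (fun b bt => ht b (mem_behead (s := a :: t) bt)).
  have [f [If sf ef]] := ht a (mem_head _ _).
  exists (f :: F) => [g|b]; first by rewrite inE => /predU1P[->|/FI].
  rewrite inE => /predU1P[->|/hF[g [gF sg eg]]].
    by exists f; rewrite mem_head.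
  by exists g; rewrite inE gF orbT.
exists (s ++ F) => [f|f If sf]; first by rewrite mem_cat => /orP[/sI|/FI].
have hJ : ideal [set a | exists g, [/\ generated F g,
  (size g <= n.+1)%N & g`_n = a]].
  split=> [|_ _ [g [Fg sg <-]] [h [Fh sh <-]]|a _ [g [Fg sg <-]]].
  - by exists 0; rewrite size_poly0 coef0; split=> //;
      exact: ideal0 (generated_ideal _).
  - exists (g + h); rewrite coefD; split=> //.
      by apply: idealD => //; exact: generated_ideal.
    by rewrite (leq_trans (size_polyD _ _)) // geq_max sg.
  - exists (a%:P * g); rewrite coefCM; split=> //.
      by apply: idealMl => //; exact: generated_ideal.
    by rewrite mul_polyC (leq_trans (size_scale_leq _ _)).
have [g [Fg sg eg]] : [set a | exists g, [/\ generated F g,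
  (size g <= n.+1)%N & g`_n = a]] f`_n.
  apply: (generated_min (s := t) hJ) => [a /hF[g [gF sg eg]]|].
    by exists g; split=> //; exact: generated_mem.
  by rewrite -et; exists f.
have Ig : I g by exact: generated_min Fg.
rewrite -(subrK g f); apply: idealD; first exact: generated_ideal.
  apply: (generatedS (s := s)) => [h|]; first by rewrite mem_cat => ->.
  by apply: IH; [exact: idealB | exact: size_sub_leading].
by apply: (generatedS (s := F)) => // h; rewrite mem_cat orbC => ->.
Qed.

(** The ideals of leading coefficients increase to [leading N]. In higher degree, an element of [I]
    loses its top term by subtracting a shift of an element of degree at most [N]; low degrees are
    finitely generated. *)
Lemma poly_ideal_generated : exists s, I = generated s.
Proof.
have hL : ideal (\bigcup_n leading n).
  split=> [|x y [n _ hx] [m _ hy]|a x [n _ hx]].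
  - by exists 0%N => //; exact: ideal0 (leading_ideal _).
  - exists (maxn n m) => //; apply: idealD; first exact: leading_ideal.
      exact: leading_mono (leq_maxl _ _) _ hx.
    exact: leading_mono (leq_maxr _ _) _ hy.
  - by exists n => //; apply: idealMl => //; exact: leading_ideal.
have [t et] := (noetherianE R).1 hR _ hL.
have [N hN] : exists N, forall a, a \in t -> leading N a.
  have : forall a, a \in t -> (\bigcup_n leading n) a.
    by rewrite et => a; exact: generated_mem.
  elim: {et} t => [_|a t IHt ht]; first by exists 0%N.
  have [N hN] := IHt (fun b bt => ht b (mem_behead (s := a :: t) bt)).
  have [M _ hM] := ht a (mem_head _ _).
  exists (maxn N M) => b; rewrite inE => /predU1P[->|/hN].
    exact: leading_mono (leq_maxr _ _) _ hM.
  exact: leading_mono (leq_maxl _ _) _.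
have LN n : leading n `<=` leading N.
  move=> a ha; have : (\bigcup_n leading n) a by exists n.
  rewrite et; apply: generated_min => //; exact: leading_ideal.
have [s sI hs] := low_degree_generated N.+1.
exists s; apply/seteqP; split; last exact: generated_min.
move=> f; have [n] := ubnP (size f); elim: n f => [//|n IH] f; rewrite ltnS.
move=> le_fn If; have [le_nN|lt_Nn] := leqP n N.+1.
  by apply: hs => //; exact: leq_trans le_nN.
case: n lt_Nn le_fn IH => [//|n] lt_Nn le_fn IH.
have [g [Ig sg eg]] : leading N f`_n by apply: (LN n); exists f.
rewrite -(subrK ('X^(n - N) * g) f); apply: idealD;
  first exact: generated_ideal.
  apply: IH; last by apply: idealB => //; exact: idealMl.
  rewrite ltnS; apply: size_sub_leading => //.
    apply: leq_trans (size_polyMleq _ _) _; rewrite size_polyXn /=.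
    by move: sg lt_Nn; move: (size g) => m; lia.
  rewrite coefXnM ifN; last by lia.
  by rewrite subKn ?eg //; lia.
apply: idealMl; first exact: generated_ideal.
exact: hs.
Qed.

End HilbertBasis.

Lemma hilbert_basis (R : comNzRingType) : noetherian R -> noetherian {poly R}.
Proof. by move=> hR; apply/noetherianE => I; exact: poly_ideal_generated. Qed.

Lemma noetherian_field (k : fieldType) : noetherian k.
Proof.
apply/noetherianE => I hI; have [[x [Ix /eqP x0]]|nI] :=
  pselect (exists x, I x /\ x <> 0).
  exists [:: 1]; apply/seteqP; split=> y _.
    by rewrite -(mulr1 y); apply: idealMl; [exact: generated_ideal | apply:
      generated_mem; exact: mem_head].
  by rewrite -(mulr1 y) -(mulVf x0) mulrA; exact: idealMl.
exists [::]; apply/seteqP; split=> y /=; last by move=> ->; exact: ideal0.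
by move=> Iy; apply: contrapT => y0; apply: nI; exists y.
Qed.

Lemma noetherian_surj (A B : comPzRingType) (f : {rmorphism A -> B}) :
  (forall b, exists a, f a = b) -> noetherian A -> noetherian B.
Proof.
move=> fsurj /noetherianE hA; apply/noetherianE => I hI.
have [s es] := hA _ (preimage_ideal f hI).
exists (map f s); apply/seteqP; split.
  move=> b Ib; have [a ea] := fsurj b; rewrite -ea in Ib *.
  have hJ : ideal (f @^-1` generated (map f s)) by exact: preimage_ideal
    (generated_ideal _).
  have : generated s a by rewrite -es.
  by move: a {ea Ib}; apply: generated_min => // x xs; apply: generated_mem;
    exact: map_f.
apply: generated_min => // _ /mapP[a as_ ->].
by have : generated s a by [exact: generated_mem]; rewrite -es.
Qed.

Lemma finitely_generated_presentation (p : nat) (k : fieldType)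
    (A : comPzRingType) (iota : {rmorphism k -> A}) :
  prime p -> p%:R = 0 :> k -> 1 != 0 :> A -> finitely_generated_algebra iota ->
  exists (R : comNzRingType) (pi : {rmorphism R -> A}),
    [/\ p%:R = 0 :> R, noetherian R, exists B : set R, p_basis p B
      & forall a, exists r, pi r = a].
Proof.
move=> p_pr p0 nz [n [x fgen]].
pose A' : comNzRingType :=
  HB.pack_for comNzRingType A (GRing.PzSemiRing_isNonZero.Build A nz).
(* Indexing by [nat], with 0 beyond [n], allows adjoining the variables by induction on their
   number. *)
pose y i : A' := if insub i is Some j then x j else 0.
have [R [pi [R0 hR RB pik piy]]] :
  exists (R : comNzRingType) (pi : {rmorphism R -> A'}),
    [/\ p%:R = 0 :> R, noetherian R, exists B : set R, p_basis p B,
      forall c, exists r, pi r = iota c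
    & forall i, (i < n)%N -> exists r, pi r = y i].
  elim: (n) => [|m [R [pi [R0 hR [B hB] pik piy]]]].
    exists k, iota; split=> //; [exact: noetherian_field | exact: field_p_basis
      |].
    by move=> c; exists c.
  have comm : commr_rmorph pi (y m) by move=> r; exact: mulrC.
  pose ev : {rmorphism {poly R} -> A'} := horner_morph comm.
  exists {poly R}, ev; split.
  - exact: poly_natr0.
  - exact: hilbert_basis.
  - by exists ('X |` (polyC @` B)); exact: poly_p_basis.
  - by move=> c; have [r <-] := pik c; exists r%:P; exact: horner_morphC.
  - move=> i; rewrite ltnS leq_eqVlt => /predU1P[->|/piy[r <-]].
      by exists 'X; exact: horner_morphX.
    by exists r%:P; exact: horner_morphC.
exists R, pi; split=> // a.
have : smallest [set S : set A | subring_closed (mem S)]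
  (range iota `|` range x) a.
  by rewrite fgen.
move=> /(_ (range pi)) [|r _ <-]; last by exists r.
split=> [|_ [[c _ <-]|[i _ <-]]].
- split=> [|_ _ /set_mem[u _ <-] /set_mem[v _ <-]|_ _ /set_mem[u _ <-]
    /set_mem[v _ <-]];
    apply/mem_set.
  + by exists 1; rewrite ?rmorph1.
  + by exists (u - v); rewrite ?rmorphB.
  + by exists (u * v); rewrite ?rmorphM.
- by have [r <-] := pik c; exists r.
- have [r er] := piy i (ltn_ord i); exists r => //.
  by rewrite er /y valK.
Qed.

(** * p-bases of localizations *)

(** The list [s] consists of the p-basis elements occurring in finitely many generators of [P]. For
    any other [b], an element of [P] can be expanded in powers of [b] with coefficients in [P], and
    such an expansion is unique. *)
Lemma pfree_set_cofinite (p : nat) (R : comPzRingType) (BB P : set R) :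
  prime p -> p%:R = 0 :> R -> noetherian R -> p_basis p BB -> ideal P ->
  exists2 s : seq R, (forall b, b \in s -> BB b)
    & pfree_set p (@pth_powers p R) P [set b | BB b /\ b \notin s].
Proof.
move=> p_pr p0 hR [fB sB] hP; set K := @pth_powers p R.
have p_gt1 := prime_gt1 p_pr; have hK := pth_powers_subring p_pr p0.
have powK := @pth_powersX p R.
have hspan s : subring (pspan p K s) by exact: pspan_subring.
have [fs efs] := (noetherianE R).1 hR _ hP.
have [s1 s1B hs1] := @pspan_set_finite _ p K p_gt1 hK powK BB fs (fun f _ =>
  sB f).
exists s1 => // s + sT; elim: s sT => [//|b s IH] sT /= /andP[nbs us].
have sT' c : c \in s -> BB c /\ c \notin s1.
  by move=> cs; apply: sT; rewrite inE cs orbT.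
have [Bb nbs1] := sT b (mem_head _ _).
split; first exact: IH.
move=> k hk; set z := \sum_(i < p) _ => Pz i lt_ip.
have [s2 s2B hz] : exists2 s2, (forall b, b \in s2 -> BB b) &
    lincomb (pspan p K s2) [set 0] fs z.
  move: Pz; rewrite efs; elim: (fs) z => [|f gs IHf] z /=.
    by move=> z0; exists [::].
  move=> [c _ /IHf[s2 s2B hz]]; have [t tB hc] := sB c.
  exists (t ++ s2) => [d|]; first by rewrite mem_cat => /orP[/tB|/s2B].
  exists c; first by apply: pspanS hc => // d; rewrite mem_cat => ->.
  apply: lincombS hz => //; apply: pspanS => // d.
  by rewrite mem_cat orbC => ->.
(* All p-basis elements in play except [b]; the powers of [b] are independent over their span. *)
pose s3 := undup [seq c <- s ++ s1 ++ s2 | c != b].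
have nb3 : b \notin s3 by rewrite mem_undup mem_filter eqxx.
have s3B c : c \in s3 -> BB c.
  rewrite mem_undup mem_filter !mem_cat => /andP[_
    /or3P[/sT'[]//|/s1B//|/s2B//]].
have sub1 : {subset s1 <= s3}.
  move=> c cs1; rewrite mem_undup mem_filter !mem_cat cs1 orbT andbT.
  by apply: contraNneq nbs1 => <-.
have sub0 : {subset s <= s3}.
  move=> c cs; rewrite mem_undup mem_filter !mem_cat cs andbT.
  by apply: contraNneq nbs => <-.
have sub2 : {subset s2 <= b :: s3}.
  move=> c cs2; rewrite inE mem_undup mem_filter !mem_cat cs2 !orbT andbT.
  by case: eqP.
have [_ fb] : pfree p K [set 0] (b :: s3).
  apply: fB => [/=|c]; first by rewrite nb3 undup_uniq.
  by rewrite inE => /predU1P[->|/s3B].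
(* The generators [fs] do not involve [b], so expanding only their multipliers in powers of [b]
   leaves every coefficient in [P]. *)
have [c [hc Pc ez]] : exists c : nat -> R, [/\ forall i, pspan p K s3 (c i),
    forall i, P (c i) & z = \sum_(i < p) c i * b ^+ i].
  have fsP f : f \in fs -> P f by rewrite efs; exact: generated_mem.
  have {}hz : lincomb (pspan p K (b :: s3)) [set 0] fs z.
    by apply: lincombS hz => //; exact: pspanS.
  move: {Pz}z hz; elim: (fs) hs1 fsP => [_ _ z ->
    |f gs IHf hs1' fsP z [h [l hl eh] hz]].
    exists (fun=> 0); split=> [j|j|]; [exact: subring0 | exact: ideal0 |].
    by rewrite big1 // => j _; rewrite mul0r.
  have [||c [hc Pc ec]] := IHf _ _ _ hz.
  - by move=> g gg; apply: hs1'; rewrite inE gg orbT.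
  - by move=> g gg; apply: fsP; rewrite inE gg orbT.
  exists (fun j => c j + l j * f); split=> [j|j|].
  - apply: subringD => //; apply: subringM => //; first exact: hl.
    by apply: pspanS (hs1' f (mem_head _ _)).
  - by apply: idealD => //; apply: idealMl => //; apply: fsP; exact: mem_head.
  - rewrite -(subrK (h * f) z) ec eh big_distrl -big_split /=.
    by apply: eq_bigr => j _; rewrite mulrDl; congr (_ + _); rewrite mulrAC.
have -> : k i = c i; last exact: Pc.
apply/eqP; rewrite -subr_eq0; apply/eqP; apply: (fb (fun j => k j - c j)) => //.
  by move=> j; apply: subringB => //; apply: pspanS (hk j).
rewrite /= -[RHS](subrr z) {1}/z ez -sumrB.
by apply: eq_bigr => j _; rewrite mulrBl.
Qed.

Section LocalPBasis.
Variables (p : nat) (A : comPzRingType) (P : set A).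
Hypotheses (p_pr : prime p) (p0 : p%:R = 0 :> A) (pP : prime_ideal P).
Local Notation K := (@pth_powers p A).

Let p_gt1 : (1 < p)%N := prime_gt1 p_pr.
Let iP : ideal P := prime_ideal_ideal pP.
Let hK : subring K := pth_powers_subring p_pr p0.
Let powK : forall c, K (c ^+ p) := @pth_powersX p A.

(** The class of [u] lies in the span of [T] over the p-th powers of the residue field at [P]; the
    denominator is kept as a p-th power. *)
Definition residually_spanned T u :=
  exists w e, [/\ ~ P w, pspan_set p K T e & P (w ^+ p * u - e)].

(* T maps to a p-basis of the residue field at P, and generates A together    *)
(* with the finitely many elements of U.                                      *)
Definition residual_p_basis (T : set A) (U : seq A) :=
  [/\ pfree_set p K P T, forall a, pspan_set p K (T `|` [set` U]) a
    & forall u, u \in U -> residually_spanned T u].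

(** Each element of [v] joins [T] if independence survives, and otherwise joins [U], being spanned
    by exchange. *)
Lemma residual_p_basis_extend T0 (v : seq A) : pfree_set p K P T0 ->
  exists (T : set A) (U : seq A), [/\ T0 `<=` T, pfree_set p K P T,
    [set` v] `<=` T `|` [set` U]
    & forall u, u \in U -> residually_spanned T u].
Proof.
elim: v T0 => [|u v IH] T0 fT0; first by exists T0, [::]; split.
have [fuT|nfuT] := pselect (pfree_set p K P (u |` T0)).
  have [T [U [sT fT sv hU]]] := IH _ fuT; exists T, U; split=> //.
    by move=> x T0x; apply: sT; right.
  move=> x /=; rewrite inE => /predU1P[->|]; last exact: sv.
  by left; apply: sT; left.
have [w [e [nPw Te Pwe]]] := pfree_set_exchange p_pr p0 pP fT0 nfuT.
have [T [U [sT fT sv hU]]] := IH _ fT0; exists T, (u :: U); split=> //.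
  move=> x /=; rewrite inE => /predU1P[->|/sv[Tx|Ux]];
    [right|left|right] => //=.
    exact: mem_head.
  by rewrite inE Ux orbT.
move=> x; rewrite inE => /predU1P[->|]; last exact: hU.
by exists w, e; split=> //; exact: pspan_setS sT _ Te.
Qed.

Lemma residual_p_basis_exists (R : comPzRingType) (pi : {rmorphism R -> A})
    (BB : set R) :
  p%:R = 0 :> R -> noetherian R -> p_basis p BB ->
  (forall a, exists r, pi r = a) ->
  exists T U, residual_p_basis T U.
Proof.
move=> pR hR hB pisurj; have [_ sB] := hB.
have [s1 s1B fs1] := pfree_set_cofinite p_pr pR hR hB (preimage_ideal pi iP).
set T0 := [set b | _] in fs1.
have [|T [U [sT fT sv hU]]] := @residual_p_basis_extend (pi @` T0) (map pi s1).
  move=> s us sT0; have [t es tT0] : exists2 t, s = map pi t & forall b,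
    b \in t -> T0 b.
    elim: s {us} sT0 => [|a s IH] sT0; first by exists [::].
    have [t -> tT0] := IH (fun b bs => sT0 b (mem_behead (s := a :: s) bs)).
    have [b Tb <-] := sT0 a (mem_head _ _); exists (b :: t) => // c.
    by rewrite inE => /predU1P[->|/tT0].
  rewrite es in us *; apply: (pfree_map (pth_powers_map_inv pisurj)).
  by apply: fs1 tT0; exact: map_uniq us.
exists T, U; split=> // a; have [r <-] := pisurj a; have [s sBB hr] := sB r.
exists (map pi s); last exact: pspan_map (@pth_powers_map p _ _ pi) hr.
move=> _ /mapP[b bs ->]; have [bs1|nbs1] := boolP (b \in s1).
  by apply: sv; exact: map_f.
by left; apply: sT; exists b => //; split=> //; exact: sBB.
Qed.

End LocalPBasis.

Lemma lincomb_min (A : comPzRingType) (Q J S : set A) (W : seq A) :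
  (forall x y, S x -> S y -> S (x + y)) -> J `<=` S ->
  (forall c w, Q c -> w \in W -> S (c * w)) -> lincomb Q J W `<=` S.
Proof.
move=> SD sJ; elim: W => [//|w W IH] SW z [c Qc hz].
rewrite -(subrK (c * w) z); apply: SD; last by apply: SW => //; exact: mem_head.
by apply: IH hz => d v Qd vW; apply: SW => //; rewrite inE vW orbT.
Qed.

Lemma pspan_finite (p : nat) (A : comPzRingType) (E : set A) (U : seq A) :
  subring E ->
  exists W : seq A, forall a, pspan p E U a -> lincomb E [set 0] W a.
Proof.
move=> hE; have E0 := subring0 hE.
elim: U => [|u U [W hW]].
  exists [:: 1] => a Ea /=; exists a => //; by rewrite mulr1 subrr.
exists [seq w * u ^+ i | i <- iota 0 p, w <- W] => _ [k hk ->].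
set W' := [seq _ | _ <- _, _ <- _].
have lD x y : lincomb E [set 0] W' x -> lincomb E [set 0] W' y ->
    lincomb E [set 0] W' (x + y).
  by apply: lincombD => [a b|_ _ -> ->]; [exact: subringD | rewrite addr0].
apply: (big_ind (lincomb E [set 0] W')) => [|//|i _]; first exact: lincomb_base.
have : lincomb E [set 0] W (k i) by exact/hW/hk.
apply: (lincomb_min (S := fun x => lincomb E [set 0] W' (x * u ^+ i))) =>
  [x y|_ ->|c w Ec wW].
- by rewrite mulrDl; exact: lD.
- by rewrite mul0r; exact: lincomb_base.
- rewrite -mulrA; apply: lincomb_mem => //.
  by apply: (allpairs_f (fun i w => w * u ^+ i)) => //;
    rewrite mem_iota ltn_ord.
Qed.

(** A repeated entry [b] would give the relation [b * 1 - 1 * b = 0], whose coefficient of degree 1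
    is [-1]. *)
Lemma pfree_uniq (p : nat) (A : comPzRingType) (K I : set A) s : (1 < p)%N ->
  subring K -> (forall c, K (c ^+ p)) -> ideal I -> ~ I 1 -> pfree p K I s ->
    uniq s.
Proof.
move=> p_gt1 hK powK hI nI1; elim: s => [//|b s IH] /= [fs fb].
have hS : subring (pspan p K s) by exact: pspan_subring.
rewrite IH // andbT; apply/negP => bs; apply: nI1; rewrite -[1]opprK.
apply: idealN => //.
pose k i : A := if i is 0 then b else if i is 1%N then -1 else 0.
apply: (fb k _ _ 1%N) => // [[|[|i]]|] /=.
- exact: pspan_mem.
- by apply: subringN => //; exact: subring1.
- exact: subring0.
case: (p) p_gt1 => [|[|q]] // _; rewrite !big_ord_recl big1 /=.
  by rewrite expr0 expr1 mulr1 mulN1r addr0 subrr; exact: ideal0.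
by move=> i _; rewrite mul0r.
Qed.

(** * Localizing primes and p-independence *)

Section LocalizedIdeal.
Variables (A B : comPzRingType) (S P : set A) (j : {rmorphism A -> B}).
Hypotheses (pP : prime_ideal P) (S1 : S 1).
Hypotheses (SM : forall s t, S s -> S t -> S (s * t)) (SP : S `<=` ~` P).
Hypothesis hj : is_localization S j.

Let iP : ideal P := prime_ideal_ideal pP.

(** The multiplicative set is left general: the complement of [P] serves for the local ring, the
    powers of [f] for the primes of [A_f]. *)
Definition localized_ideal : set B :=
  [set b | exists a s, [/\ P a, S s & j s * b = j a]].
Local Notation m := localized_ideal.

Lemma localization_eq a a' : j a = j a' -> exists2 s, S s & s * a = s * a'.
Proof.
case: hj => _ _ hker /eqP; rewrite -subr_eq0 -rmorphB => /eqP/hker[s Ss].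
by rewrite mulrBr => /eqP; rewrite subr_eq0 => /eqP; exists s.
Qed.

Lemma localized_idealE a : m (j a) <-> P a.
Proof.
split=> [[a' [s [Pa' Ss]]]|Pa]; last by exists a, 1; rewrite rmorph1 mul1r.
rewrite -rmorphM => /localization_eq[t St e].
apply: (primeMl pP (x := s)); last exact: SP.
apply: (primeMl pP (x := t)); last exact: SP.
by rewrite e; exact: idealMl.
Qed.

Lemma localized_ideal_prime : prime_ideal m.
Proof.
case: (hj) => junit jsurj _.
have cancel s b : S s -> m (j s * b) -> m b.
  move=> Ss [a [t [Pa St e]]]; exists a, (t * s); split=> //; first exact: SM.
  by rewrite rmorphM -mulrA.
split; [split=> [|x y [a [s [Pa Ss ex]]] [b [t [Pb St ey]]]|x y [b [t [Pb St
  ey]]]]| |].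
- by rewrite -(rmorph0 j); apply/localized_idealE; exact: ideal0.
- exists (t * a + s * b), (s * t); split; last 1 first.
  + by rewrite rmorphD !rmorphM -ex -ey; ring.
  + by apply: idealD => //; exact: idealMl.
  + exact: SM.
- have [c [u [Su ex]]] := jsurj x; exists (c * b), (u * t); split.
  + exact: idealMl.
  + exact: SM.
  + by rewrite !rmorphM -ex -ey; ring.
- by rewrite -(rmorph1 j) => /localized_idealE; exact: prime1.
move=> x y mxy; have [a [s [Ss ex]]] := jsurj x;
  have [b [t [St ey]]] := jsurj y.
have : m (j (a * b)).
  rewrite rmorphM -ex -ey; have [c [u [Pc Su e]]] := mxy.
  exists (s * t * c), u; split=> //; first exact: idealMl.
  by rewrite !rmorphM -e; ring.
move=> /localized_idealE; case: pP => _ _ /[apply] -[Pa|Pb]; [left|right].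
  by exists a, s.
by exists b, t.
Qed.

End LocalizedIdeal.

Section Localization.
Variables (p : nat) (A B : comPzRingType) (P : set A) (j : {rmorphism A -> B}).
Hypotheses (pP : prime_ideal P) (hj : is_localization (~` P) j).
Local Notation m := (localized_ideal (~` P) P j).

Let nP1 : (~` P) 1 := prime1 pP.
Let nPM s t : (~` P) s -> (~` P) t -> (~` P) (s * t) := @primeM _ _ _ _ pP.

Lemma localized_maximalE a : m (j a) <-> P a.
Proof. exact: (localized_idealE pP nP1 (@subset_refl _ _) hj). Qed.

Lemma localized_local : local_at m.
Proof.
split; first exact: (localized_ideal_prime pP nP1 nPM (@subset_refl _ _) hj).
case: (hj) => junit jsurj _ x nmx; have [a [s [nPs e]]] := jsurj x.
have nPa : ~ P a by move=> Pa; apply: nmx; exists a, s.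
have [b ab1] := junit a nPa; exists (j s * b).
by rewrite mulrA [x * _]mulrC e.
Qed.

Lemma localized_maximal : maximal_ideal m.
Proof.
have [[im m1 _] Munit] := localized_local; split=> // I hI nI1 sI.
apply/seteqP; split=> // x Ix; apply: contrapT => /Munit[z xz].
by apply: nI1; rewrite -xz; exact: idealMr.
Qed.

Lemma localized_lincomb ys b : generated (map j ys) b ->
  exists s a, [/\ ~ P s, j s * b = j a & generated ys a].
Proof.
elim: ys b => [|y ys IH] b /=.
  by move=> ->; exists 1, 0; rewrite mulr0 rmorph0; split=> //; exact: prime1.
move=> [c _ /IH[s [a [nPs e gen]]]]; case: hj => _ jsurj _.
have [d [t [nPt ec]]] := jsurj c.
exists (s * t), (t * a + s * d * y); split; first exact: primeM.
  rewrite rmorphD !rmorphM -e -ec; ring.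
exists (s * d) => //; rewrite addrK; apply: lincombZ gen => // _ ->.
by rewrite mulr0.
Qed.

Hypothesis (p_pr : prime p) (p0 : p%:R = 0 :> A).
Local Notation K := (@pth_powers p A).
Local Notation KB := (@pth_powers p B).

Let p_gt1 : (1 < p)%N := prime_gt1 p_pr.
Let hK : subring K := pth_powers_subring p_pr p0.
Let powK : forall c, K (c ^+ p) := @pth_powersX p A.
Let hspan s : subring (pspan p K s) := pspan_subring p_gt1 hK powK s.

(** Denominators are p-th powers, so bringing the first [n] fractions to a common one keeps the
    numerators in the span. *)
Lemma common_denominator (s : seq A) (k : nat -> B) n :
  (forall i, exists t x, [/\ ~ P t, pspan p K s x & j (t ^+ p) * k i = j x]) ->
  exists t (x : nat -> A), [/\ ~ P t, forall i, pspan p K s (x i)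
    & forall i, (i < n)%N -> j (t ^+ p) * k i = j (x i)].
Proof.
move=> hk; elim: n => [|n [t [x [nPt hx e]]]].
  by exists 1, (fun=> 0); split=> // i; exact: subring0 (hspan s).
have [u [y [nPu hy ey]]] := hk n.
have hu v : pspan p K s (v ^+ p) by exact: sub_pspan.
exists (t * u), (fun i => if (i == n)%N then t ^+ p * y else u ^+ p * x i);
  split.
- exact: primeM.
- by move=> i; case: ifP => _; apply: (subringM (hspan s)).
- move=> i; rewrite ltnS leq_eqVlt exprMn rmorphM; case: eqP => [->|_] /= lt_in.
    by rewrite rmorphM -ey mulrA.
  by rewrite rmorphM -e //; ring.
Qed.

Lemma pspan_localized s z : pspan p KB (map j s) z ->
  exists t x, [/\ ~ P t, pspan p K s x & j (t ^+ p) * z = j x].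
Proof.
elim: s z => [|b s IH] z /=.
  move=> [c _ <-]; case: hj => _ jsurj _; have [a [t [nPt e]]] := jsurj c.
  exists t, (a ^+ p); split=> //.
  by rewrite rmorphXn -exprMn e rmorphXn.
move=> [k hk ->].
have [t [x [nPt hx e]]] := common_denominator p (fun i => IH _ (hk i)).
exists t, (\sum_(i < p) x i * b ^+ i); split=> //; first by exists x.
rewrite big_distrr rmorph_sum; apply: eq_bigr => i _ /=.
by rewrite mulrA e // rmorphM [j (b ^+ i)]rmorphXn.
Qed.

Lemma pfree_localized s : pfree p K P s -> pfree p KB m (map j s).
Proof.
elim: s => [//|b s IH] /= [fs fb]; split; first exact: IH.
move=> k hk msum i lt_ip; have [im _ mM] := localized_local.1.
have [t [x [nPt hx e]]] := common_denominator p (fun i =>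
  pspan_localized (hk i)).
have Px : P (\sum_(i < p) x i * b ^+ i).
  apply/localized_maximalE.
  have -> : j (\sum_(i < p) x i * b ^+ i)
      = j (t ^+ p) * \sum_(i < p) k i * j b ^+ i.
    rewrite big_distrr rmorph_sum; apply: eq_bigr => i' _ /=.
    by rewrite mulrA e // rmorphM [j (b ^+ i')]rmorphXn.
  exact: idealMl.
have : m (j (t ^+ p) * k i) by rewrite e //; apply/localized_maximalE;
  exact: fb.
by move=> /mM[/localized_maximalE Pt|//]; case: nPt; exact: primeXE Pt.
Qed.

End Localization.

Lemma has_prime_chain_from (A : comPzRingType) n : has_prime_chain A n ->
  exists Q : set A, prime_chain_from n Q.
Proof.
move=> [Q [pQ sQ]]; exists (Q 0%N); elim: n Q pQ sQ => [|n IH] Q pQ sQ.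
  by split=> //; exact: pQ.
split; first exact: pQ.
exists (Q 1%N); first exact: sQ.
by apply: (IH (fun i => Q i.+1)) => i hi; [exact: pQ | exact: sQ].
Qed.

Section RegularLocalization.
Variables (p : nat) (A B : comPzRingType) (P : set A) (j : {rmorphism A -> B}).
Hypotheses (p_pr : prime p) (p0 : p%:R = 0 :> A).
Hypotheses (pP : prime_ideal P) (hj : is_localization (~` P) j).
Hypotheses (hA : noetherian A) (hB : regular_local_ring B).
Local Notation K := (@pth_powers p A).
Local Notation KB := (@pth_powers p B).
Local Notation m := (localized_ideal (~` P) P j).

Let p_gt1 : (1 < p)%N := prime_gt1 p_pr.
Let p_gt0 : (0 < p)%N := prime_gt0 p_pr.
Let iP : ideal P := prime_ideal_ideal pP.
Let hK : subring K := pth_powers_subring p_pr p0.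
Let powK : forall c, K (c ^+ p) := @pth_powersX p A.
Let hset T : subring (pspan_set p K T) := pspan_set_subring p_gt1 hK powK T.
Let hm : local_at m := localized_local pP hj.

Let pB0 : p%:R = 0 :> B. Proof. by rewrite -(rmorph_nat j) p0 rmorph0. Qed.

(** Generators of the maximal ideal are replaced by numerators in [A], which differ from them by
    units. There are as many as the dimension, so a prime chain of that length yields the flag. *)
Lemma regular_parameters : exists ys : seq A,
  [/\ forall y, y \in ys -> P y, forall z, m z <-> generated (map j ys) z
    & regular_flag m [set 0] (map j ys)].
Proof.
have [nB [m' [maxm' uniqm'] [d [chain _] [x em']]]] := hB.
have em : m = ideal_gen x by rewrite -em'; apply: uniqm';
  exact: localized_maximal.
have im : ideal m := prime_ideal_ideal hm.1.
have /choice[y hy] : forall i : 'I_d, exists y, P y /\ exists s,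
  ~ P s /\ j s * x i = j y.
  move=> i; have [y [s [Py nPs e]]] : m (x i).
    by rewrite em ideal_genE; apply: generated_mem; exact: codom_f.
  by exists y; split=> //; exists s.
have Py z : z \in codom y -> P z by move=> /codomP[i ->]; have [] := hy i.
have gen z : m z <-> generated (map j (codom y)) z.
  split; last first.
    apply: generated_min => // _ /mapP[w /Py Pw ->]; exact/localized_maximalE.
  rewrite em ideal_genE; apply: generated_min; first exact: generated_ideal.
  move=> _ /codomP[i ->]; have [_ [s [nPs e]]] := hy i.
  have [junit _ _] := hj; have [v sv] := junit s nPs.
  rewrite -(mul1r (x i)) -sv mulrAC e; apply: idealMr;
    first exact: generated_ideal.
  by apply: generated_mem; apply: map_f; exact: codom_f.
exists (codom y); split=> //.
have [Q hQ] := has_prime_chain_from chain.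
have [] // := @regular_flag_of_chain B m [set 0] (map j (codom y)) Q nB hm.
- exact: zero_ideal.
- by move=> _ ->; exact: ideal0 (prime_ideal_ideal (prime_chain_from_prime hQ)).
- by rewrite size_map size_codom card_ord.
Qed.

Section RegularSystem.
Variables (T : set A) (U ys : seq A).
Hypothesis hTU : residual_p_basis p P T U.
Hypothesis ysP : forall y, y \in ys -> P y.
Hypothesis genm : forall z, m z <-> generated (map j ys) z.
Hypothesis flag : regular_flag m [set 0] (map j ys).
Local Notation BB := (T `|` [set` ys]).
Local Notation E := (pspan_set p K BB).

Lemma pfree_parameters t : uniq t -> (forall b, b \in t -> BB b) ->
  pfree p KB [set 0] (map j t).
Proof.
move=> ut tBB; have [nB _] := hB; have [fT _ _] := hTU.
have hKB := pth_powers_subring p_pr pB0; have powKB := @pth_powersX p B.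
pose s := [seq b <- t | b \notin ys].
have fs : pfree p K P s.
  apply: fT => [|b]; first exact: filter_uniq.
  rewrite mem_filter => /andP[nb /tBB[//|/= b_ys]].
  by rewrite b_ys in nb.
have fys : pfree p KB [set 0] (map j (ys ++ s)).
  rewrite map_cat; apply: (pfree_regular_flag p_pr pB0 nB hm flag).
  exact: pfree_localized.
have nB1 : ~ [set (0 : B)] 1.
  move=> /= e; have [_ m1 _] := hm.1; apply: m1; rewrite e; apply: ideal0.
  exact: prime_ideal_ideal hm.1.
have uys : uniq (ys ++ s).
  exact: map_uniq (pfree_uniq p_gt1 hKB powKB (zero_ideal B) nB1 fys).
(* [t] need not contain all parameters; the missing entries are put in front, and freeness passes to
   the tail of a list. *)
pose r := [seq b <- ys ++ s | b \notin t].
have hperm : perm_eq (ys ++ s) (r ++ t).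
  apply: uniq_perm => [//||b].
    rewrite cat_uniq filter_uniq // ut andbT; apply/hasPn => b bt.
    by rewrite mem_filter bt.
  rewrite !mem_cat !mem_filter !mem_cat mem_filter.
  by case: (b \in t); case: (b \in ys).
have : pfree p KB [set 0] (map j (r ++ t)).
  by apply: pfree_perm fys => //; [exact: zero_ideal | exact: perm_map].
by rewrite map_cat; elim: (map j r) => [//|c r' IH] /= [/IH].
Qed.

(** The residually spanned elements form a subring containing [K], [T] and [U]. *)
Lemma residually_spanned_all a : residually_spanned p P BB a.
Proof.
have [_ sA hU] := hTU.
have mono u : residually_spanned p P T u -> residually_spanned p P BB u.
  move=> [w [e [nPw Te Pwe]]]; exists w, e; split=> //.
  by apply: pspan_setS Te => x Tx; left.
have inE' e : E e -> residually_spanned p P BB e.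
  move=> Ee; exists 1, e; rewrite expr1n mul1r subrr.
  by split=> //; [exact: prime1 | exact: ideal0].
have Epow w : E (w ^+ p) by exact: sub_pspan_set.
have hS : subring (residually_spanned p P BB).
  split=> [|x y [w [e [nPw Te Pwe]]] [v [d [nPv Td Pvd]]]
           |x y [w [e [nPw Te Pwe]]] [v [d [nPv Td Pvd]]]].
  - by apply: inE'; exact: subring1.
  - exists (w * v), (v ^+ p * e - w ^+ p * d); split; first exact: primeM.
      by apply: subringB => //; exact: subringM.
    have -> : (w * v) ^+ p * (x - y) - (v ^+ p * e - w ^+ p * d)
        = v ^+ p * (w ^+ p * x - e) - w ^+ p * (v ^+ p * y - d).
      by rewrite exprMn; ring.
    by apply: idealB => //; exact: idealMl.
  - exists (w * v), (e * d); split; first exact: primeM.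
      exact: subringM.
    have -> : (w * v) ^+ p * (x * y) - e * d
        = w ^+ p * x * (v ^+ p * y - d) + d * (w ^+ p * x - e).
      by rewrite exprMn; ring.
    by apply: idealD => //; exact: idealMl.
apply: (pspan_set_min hS _ _ (sA a)) => [x Kx|x [Tx|/= Ux]].
- by apply: inE'; exact: sub_pspan_set.
- by apply: inE'; apply: pspan_set_mem => //; left.
- exact/mono/hU.
Qed.

Lemma prime_generated z : P z -> exists2 s, ~ P s & generated ys (s * z).
Proof.
move=> /(localized_maximalE pP hj)/genm/(localized_lincomb pP hj)[s [a [nPs e
  gen]]].
move: e; rewrite -rmorphM => /(localization_eq hj)[t nPt e].
exists (t * s); first exact: primeM.
by rewrite -mulrA e; apply: idealMl => //; exact: generated_ideal.
Qed.

(** [A] is a finite [E]-module. Up to p-th power denominators, which lie in [E], each element of [A]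
    lies in [E] plus the ideal generated by [ys]; since [ys] lies in both [E] and [P], Nakayama's
    lemma applies modulo [E]. *)
Lemma conductor_exists : exists g, [/\ E g, ~ P g & forall a, E (g * a)].
Proof.
have [_ sA _] := hTU; have E0 : E 0 by exact: subring0.
have Epow w : E (w ^+ p) by exact: sub_pspan_set.
have [W hW] := pspan_finite p U (hset BB).
have allW a : lincomb E [set 0] W a.
  apply: hW; have powE c : E (c ^+ p) by [].
  apply: (pspan_set_min (pspan_subring p_gt1 (hset BB) powE U) _ _ (sA a)).
    by move=> x Kx; apply: sub_pspan => //; exact: sub_pspan_set.
  move=> x [Tx|/= Ux]; last exact: pspan_mem.
  by apply: sub_pspan => //; apply: pspan_set_mem => //; left.
have [|||g [Eg nPg gW]] := @nakayama A E P E W (hset BB) pP E0.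
- by move=> x y; exact: subringD.
- by move=> x y; exact: subringM.
- move=> w _; have [v [e [nPv Ee Pve]]] := residually_spanned_all w.
  have [t nPt gen] := prime_generated Pve.
  exists ((t * v) ^+ p); split=> //; first by apply: primeX => //;
    exact: primeM.
  (* The first summand lies in the ideal generated by [ys], the second in [E]. *)
  have -> : (t * v) ^+ p * w = t ^+ p.-1 * (t * (v ^+ p * w - e)) + t ^+ p * e.
    by rewrite exprMn -[in t ^+ p](prednK p_gt0) exprSr; ring.
  have lD x y : lincomb (E `&` P) E W x -> lincomb (E `&` P) E W y ->
      lincomb (E `&` P) E W (x + y).
    apply: lincombD => [a b [Ea Pa] [Eb Pb]|a b Ea Eb]; last exact: subringD.
    by split; [exact: subringD | exact: idealD].
  have E0P : (E `&` P) 0 by split=> //; exact: ideal0.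
  apply: (lD); last by apply: lincomb_base => //; exact: subringM.
  have : generated ys (t ^+ p.-1 * (t * (v ^+ p * w - e))).
    by apply: idealMl => //; exact: generated_ideal.
  apply: (lincomb_min (S := lincomb (E `&` P) E W)) => [//|_ ->|c y _ yys].
    exact: lincomb_base.
  (* The multiplier [c] is an arbitrary element of [A], hence an [E]-combination of [W]; the factor
     [y] puts its coefficients into [P]. *)
  rewrite mulrC; move: (allW c); apply: lincombZ => [a Ea|_ ->].
    split; last by apply: idealMr => //; exact: ysP.
    by apply: subringM => //; apply: pspan_set_mem => //; right.
  by rewrite mulr0.
exists g; split=> // a; move: (allW a).
apply: (lincomb_min (S := fun x => E (g * x))) => [x y|_ ->|c w Ec wW].
- by rewrite mulrDr; exact: subringD.
- by rewrite mulr0.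
- by rewrite mulrCA; apply: subringM => //; exact: gW.
Qed.

End RegularSystem.

(** The kernel of the localization map is finitely generated, so a product of annihilators of its
    generators kills all of it. *)
Lemma kernel_annihilator : exists2 s, ~ P s & forall a, j a = 0 -> s * a = 0.
Proof.
have [ns ens] := (noetherianE A).1 hA _ (preimage_ideal j (zero_ideal B)).
have [s nPs hs] : exists2 s, ~ P s & forall a, a \in ns -> s * a = 0.
  have : forall a, a \in ns -> j a = 0.
    by move=> a ans; have : generated ns a by [exact: generated_mem];
      rewrite -ens.
  elim: (ns) => [_|a l IH hl]; first by exists 1 => //; exact: prime1.
  have [s nPs hs] := IH (fun b bl => hl b (mem_behead (s := a :: l) bl)).
  have [t nPt ta0] : exists2 t, ~ P t & t * a = 0.
    by case: hj => _ _ /(_ a (hl a (mem_head _ _)))[t]; exists t.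
  exists (s * t); first exact: primeM.
  move=> b; rewrite inE => /predU1P[->|/hs sb0];
    first by rewrite -mulrA ta0 mulr0.
  by rewrite mulrAC sb0 mul0r.
exists s => // a ja0; have : generated ns a by rewrite -ens.
apply: (generated_min (I := [set x | s * x = 0])) => //.
split=> [|x y|b x] /=; first by rewrite mulr0.
  by rewrite mulrDr => -> ->; rewrite addr0.
by rewrite mulrCA => ->; rewrite mulr0.
Qed.

Lemma local_p_basis T U : residual_p_basis p P T U ->
  exists2 g, ~ P g & forall (C : comPzRingType) (f : {rmorphism A -> C})
    (h : {rmorphism C -> B}), (forall a, h (f a) = j a) ->
    is_localization (powers g) f -> exists BC : set C, p_basis p BC.
Proof.
move=> hTU; have [ys [ysP genm flag]] := regular_parameters.
set BB := T `|` [set` ys]; pose E := pspan_set p K BB.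
have [g0 [Eg0 nPg0 g0E]] := conductor_exists hTU ysP genm.
have [s nPs sker] := kernel_annihilator.
have hE : subring E by exact: hset.
have Epow w : E (w ^+ p) by exact: sub_pspan_set.
(* The p-th power of [s] keeps [g] in [E] while still killing the kernel; this makes [h]
   injective. *)
pose g := g0 * s ^+ p.
have Eg : E g by exact: subringM.
have gE a : E (g * a).
  by rewrite /g mulrAC; apply: subringM => //; exact: g0E.
have gker a : j a = 0 -> g * a = 0.
  by move=> /sker sa0; rewrite /g -(prednK p_gt0) exprSr -!mulrA sa0 !mulr0.
exists g; first by apply: primeM => //; exact: primeX.
move=> C f h hf [funit fsurj _].
have [v fgv] := funit g (ex_intro2 _ _ 1%N I (expr1 g)).
have pC0 : p%:R = 0 :> C by rewrite -(rmorph_nat f) p0 rmorph0.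
have hKC := pth_powers_subring p_pr pC0; have powKC := @pth_powersX p C.
have hinj c : h c = 0 -> c = 0.
  move=> hc0; have [a [_ [[n _ <-] e]]] := fsurj c.
  have : g * a = 0 by apply: gker; rewrite -hf -e rmorphM hc0 mulr0.
  move=> /(congr1 f); rewrite rmorphM -e rmorph0 mulrA -rmorphM -exprS rmorphXn.
  move=> /(congr1 (fun x => v ^+ n.+1 * x)).
  by rewrite mulr0 mulrA -exprMn [v * _]mulrC fgv expr1n mul1r.
exists (f @` BB); split.
  move=> t ut tBB; have [t' et t'BB] : exists2 t', t = map f t' & forall b,
    b \in t' -> BB b.
    elim: t {ut} tBB => [|a t IH] tBB; first by exists [::].
    have [t' -> t'BB] := IH (fun b bs => tBB b (mem_behead (s := a :: t) bs)).
    have [b Tb <-] := tBB a (mem_head _ _); exists (b :: t') => // c.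
    by rewrite inE => /predU1P[->|/t'BB].
  have ut' : uniq t' by move: ut; rewrite et; exact: map_uniq.
  have := pfree_parameters hTU flag ut' t'BB.
  have -> : map j t' = map h t by rewrite et -map_comp; apply: eq_map => a /=;
    rewrite hf.
  move=> /(pfree_comap (@pth_powers_map p _ _ h)).
  suff -> : h @^-1` [set 0] = [set 0] by [].
  by apply/seteqP; split=> [c /hinj|_ ->] //; rewrite /preimage /= rmorph0.
move=> c; have [a [_ [[n _ <-] e]]] := fsurj c.
(* The fraction [a / g^n] is rewritten with the p-th power [g^(p (n+1))] as denominator. The
   numerator [g^(N+1) a] contains at least one factor [g], so it lies in [E]. *)
pose N := (p * n.+1 - n.+1)%N.
have eN : (p * n.+1 = N.+1 + n)%N.
  by rewrite /N addSn -addnS subnK // leq_pmull.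
have -> : c = (v ^+ n.+1) ^+ p * f (g ^+ N.+1 * a).
  rewrite rmorphM -e [f _ * (_ * c)]mulrA -rmorphM -exprD -eN rmorphXn mulrA.
  by rewrite -exprM [(_ * p)%N]mulnC -exprMn [v * _]mulrC fgv expr1n mul1r.
apply: subringM; first exact: pspan_set_subring.
  by apply: sub_pspan_set; exact: powKC.
have [r rBB hr] : E (g ^+ N.+1 * a).
  by rewrite exprSr -mulrA; apply: subringM => //; exact: subringX.
exists (map f r); last exact: (pspan_map (@pth_powers_map p _ _ f) hr).
by move=> _ /mapP[b br ->]; exists b => //; exact: rBB.
Qed.

End RegularLocalization.

(** * From nested expansions to p-monomials *)

Lemma monomialE (C : comPzRingType) (a : {fsfun C -> nat with 0%N})
    (r : seq C) :
  uniq r -> {subset finsupp a <= r} -> monomial a = \prod_(b <- r) b ^+ a b.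
Proof.
move=> ur sr; rewrite /monomial [RHS](bigID (mem (finsupp a))) /=.
rewrite [X in _ = _ * X]big1 ?mulr1 => [|b nb]; last by rewrite fsfun_dflt.
rewrite -[RHS]big_filter; apply: perm_big; apply: uniq_perm.
- exact: fset_uniq.
- exact: filter_uniq.
- by move=> b; rewrite mem_filter; apply/idP/andP => [h|[]//]; split=> //;
    exact: sr.
Qed.

Section AbsolutePBasis.
Variables (p : nat) (C : comPzRingType).
Hypotheses (p_pr : prime p) (p0 : p%:R = 0 :> C).
Local Notation K := (@pth_powers p C).

Let p_gt1 : (1 < p)%N := prime_gt1 p_pr.
Let hK : subring K := pth_powers_subring p_pr p0.
Let powK : forall c, K (c ^+ p) := @pth_powersX p C.
Let hspan s : subring (pspan p K s) := pspan_subring p_gt1 hK powK s.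

(** Grouping the terms by the exponent of the head [b] gives a relation in powers of [b]; each of
    its coefficients is a relation between monomials in the tail, again distinct because their
    exponents of [b] agree. *)
Lemma pfree_monomials (J : eqType) (I : set C) (r : seq C) (S : seq J)
    (a : J -> C -> nat) (c : J -> C) : pfree p K I r ->
  uniq [seq [seq a i b | b <- r] | i <- S] ->
  (forall i, i \in S -> K (c i)) ->
  (forall i b, i \in S -> b \in r -> (a i b < p)%N) ->
  I (\sum_(i <- S) c i * \prod_(b <- r) b ^+ a i b) ->
  forall i, i \in S -> I (c i).
Proof.
elim: r S => [|b r IH] S /=.
  move=> _; case: S => [//|i [|i' S]] //=.
  by rewrite big_seq1 big_nil mulr1 => _ _ _ Ic j; rewrite inE => /eqP->.
move=> [fr fb] uS Kc ltp Isum.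
pose k e := \sum_(i <- S | a i b == e) c i * \prod_(b' <- r) b' ^+ a i b'.
have hk e : pspan p K r (k e).
  rewrite /k big_seq_cond; apply: subring_sum => // i /andP[iS _].
  apply: subringM => //; first by apply: sub_pspan => //; exact: Kc.
  rewrite big_seq; apply: big_ind => [|x y|b' b'r];
    [exact: subring1|exact: subringM|].
  by apply: subringX => //; exact: pspan_mem.
have Ik : I (\sum_(e < p) k e * b ^+ e).
  move: Isum; congr I; rewrite /k.
  under [RHS]eq_bigr do rewrite big_distrl big_mkcond /=.
  rewrite exchange_big /= big_seq [RHS]big_seq; apply: eq_bigr => i iS.
  rewrite -big_mkcond (big_pred1 (Ordinal (ltp i b iS (mem_head _ _)))) /=.
    by rewrite big_cons mulrCA mulrC.
  by move=> e; rewrite /= -val_eqE /= eq_sym.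
move=> i iS; have lt_ip := ltp i b iS (mem_head _ _).
pose S' := [seq i' <- S | a i' b == a i b].
have sS' i' : i' \in S' -> i' \in S by rewrite mem_filter => /andP[].
apply: (IH S') => //; last by rewrite mem_filter eqxx.
- apply: (map_uniq (f := cons (a i b))); rewrite -map_comp.
  have := subseq_uniq (map_subseq _ (filter_subseq _ _)) uS.
  move=> /(_ (fun i' => a i' b == a i b)); congr uniq; apply/eq_in_map => i'.
  by rewrite mem_filter /= => /andP[/eqP->].
- by move=> i' /sS'; exact: Kc.
- by move=> i' b' /sS' i'S b'r; apply: ltp => //; rewrite inE b'r orbT.
- by have := fb k hk Ik _ lt_ip; rewrite /k big_filter.
Qed.

Fixpoint exponents n : seq (seq nat) :=
  if n is n'.+1 then [seq e :: a | e <- iota 0 p, a <- exponents n']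
  else [:: [::]].

Lemma exponents_uniq n : uniq (exponents n).
Proof.
elim: n => [//|n IH]; apply: allpairs_uniq => //; first exact: iota_uniq.
by move=> [e a] [e' a'] _ _ [-> ->].
Qed.

Lemma mem_exponents n a : a \in exponents n ->
  size a = n /\ forall i, (nth 0 a i < p)%N.
Proof.
elim: n a => [|n IH] a.
  by rewrite inE => /eqP->; split=> // i; rewrite nth_nil prime_gt0.
move=> /allpairsP[[e b] /= [+ /IH[sb hb] ->]]; rewrite mem_iota add0n => lt_ep.
by split=> [|[|i]] //=; rewrite sb.
Qed.

Lemma pspan_exponents r x : pspan p K r x -> exists2 c : seq nat -> C,
  (forall a, K (c a)) &
  x = \sum_(a <- exponents (size r)) c a * \prod_(z <- zip r a) z.1 ^+ z.2.
Proof.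
elim: r x => [|b r IH] x /=.
  by move=> Kx; exists (fun=> x) => //; rewrite big_seq1 big_nil mulr1.
move=> [k hk ->].
have /choice[c hc] : forall i, exists c : seq nat -> C, (forall a, K (c a)) /\
    k i = \sum_(a <- exponents (size r)) c a * \prod_(z <- zip r a) z.1 ^+ z.2.
  by move=> i; have [c Kc ec] := IH _ (hk i); exists c.
exists (fun a => if a is e :: a' then c e a' else 0).
  by case=> [|e a]; [exact: subring0 | have [] := hc e].
rewrite big_allpairs_dep -[iota 0 p](_ : index_iota 0 p = _);
  last by rewrite /index_iota subn0.
rewrite big_mkord; apply: eq_bigr => e _.
have [_ ->] := hc e; rewrite big_distrl; apply: eq_bigr => a _ /=.
by rewrite big_cons /= mulrA mulrAC -mulrA mulrCA mulrC -!mulrA.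
Qed.

Definition exponent_fsfun (r : seq C) (a : seq nat) :
    {fsfun C -> nat with 0%N} :=
  [fsfun b in seq_fset tt r => nth 0 a (index b r)].

Lemma exponent_fsfunE r a b : size a = size r ->
  exponent_fsfun r a b = nth 0 a (index b r).
Proof.
move=> sa; rewrite fsfunE seq_fsetE; case: ifPn => // nb.
by rewrite nth_default // memNindex // sa.
Qed.

Lemma prod_exponent_fsfun (r : seq C) (a : seq nat) : uniq r ->
  size a = size r ->
  \prod_(b <- r) b ^+ nth 0 a (index b r) = \prod_(z <- zip r a) z.1 ^+ z.2.
Proof.
elim: r a => [|b r IH] [|e a] //=; first by rewrite !big_nil.
move=> /andP[nbr ur] [sa].
rewrite !big_cons /= eqxx -IH //; congr (_ * _).
rewrite big_seq [RHS]big_seq; apply: eq_bigr => b' b'r.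
by case: eqP => // eb; rewrite eb b'r in nbr.
Qed.

Lemma absolute_p_basis_of (B : set C) : p_basis p B -> absolute_p_basis p B.
Proof.
move=> [fB sB]; split=> [s c us Dc sum0 i|x].
  (* All monomials of the relation are read in one common list, with zero exponents filled in. *)
  pose r := undup (flatten [seq (finsupp a : seq C) | a <- s]).
  have ur : uniq r by exact: undup_uniq.
  have mem_r a : a \in s -> {subset finsupp a <= r}.
    move=> as_ b ba; rewrite mem_undup; apply/flattenP;
      exists (finsupp a : seq C) => //.
    by apply/mapP; exists a.
  have rB b : b \in r -> B b.
    rewrite mem_undup => /flattenP[_ /mapP[a as_ ->] ba].
    by have [/(_ b)[+ _] _] := Dc a as_; apply.
  suff : forall a, a \in s -> [set (0 : C)] (c a) by move=> /(_ i).
  apply: (pfree_monomials (a := fun (a : {fsfun C -> nat with 0%N}) b =>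
    a b) (fB r ur rB)).
  - rewrite map_inj_in_uniq // => a a' as_ a's eaa'; apply/fsfunP => b.
    have [br|nbr] := boolP (b \in r).
      by have /eq_in_map := eaa'; apply.
    by rewrite !fsfun_dflt //; apply: contraNN nbr; apply: mem_r.
  - by move=> a as_; have [_] := Dc a as_.
  - by move=> a b as_ _; have [/(_ b)[_ lt_ab] _] := Dc a as_.
  - rewrite /= -[RHS]sum0 big_seq [RHS]big_seq; apply: eq_bigr => a as_.
    by rewrite (monomialE ur (mem_r _ as_)).
(* Duplicates are removed so that each element has its exponent at a single position of the list. *)
have [r' r'B hx] := sB x; pose r := undup r'.
have ur : uniq r by exact: undup_uniq.
have rB b : b \in r -> B b by rewrite mem_undup => /r'B.
have {}hx : pspan p K r x.
  by apply: pspanS hx => // b; rewrite mem_undup.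
have [c Kc ->] := pspan_exponents hx.
exists [seq exponent_fsfun r a | a <- exponents (size r)].
exists (fun f : {fsfun C -> nat with 0%N} => c [seq f b | b <- r]).
have valE a : a \in exponents (size r) ->
  [seq exponent_fsfun r a b | b <- r] = a.
  move=> /mem_exponents[sa _]; apply: (@eq_from_nth _ 0);
    rewrite size_map // => i lt_i.
  by rewrite (nth_map 0) // exponent_fsfunE // index_uniq.
split.
- rewrite map_inj_in_uniq ?exponents_uniq // => a a' ha ha' e.
  by rewrite -(valE a ha) -(valE a' ha') e.
- move=> _ /mapP[a /mem_exponents[sa lt_a] ->]; split; last exact: Kc.
  move=> b; rewrite exponent_fsfunE //; split=> // bs; apply: rB.
  apply: contraLR bs => nbr; rewrite memNfinsupp exponent_fsfunE //.
  by rewrite nth_default // memNindex // sa.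
- rewrite big_map big_seq [RHS]big_seq; apply: eq_bigr => a ha.
  rewrite valE //; congr (_ * _); have [sa _] := mem_exponents ha.
  rewrite (@monomialE _ _ r) // => [|b].
    rewrite -prod_exponent_fsfun //; apply: eq_bigr => b _.
    by rewrite exponent_fsfunE.
  apply: contraLR => nbr; rewrite memNfinsupp exponent_fsfunE //.
  by rewrite nth_default // memNindex // sa.
Qed.

End AbsolutePBasis.

(** * Affine charts *)

Lemma prime_spectrum_eq (A : comPzRingType) (P Q : prime_spectrum A) :
  prime_set P = prime_set Q -> P = Q.
Proof. by case: P Q => P hP [Q hQ] /= e; subst Q; congr PrimeSpectrum;
  exact: Prop_irrelevance. Qed.

Lemma open_basic (A : comPzRingType) (f : A) : open (basic_open f).
Proof.
exists [set f]; apply/seteqP; split=> P /= nPf sP; apply: nPf; first exact: sP.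
by move=> _ ->.
Qed.

Lemma open_basic_sub (A : comPzRingType) (W : set (prime_spectrum A)) P :
  open W -> W P -> exists2 f, basic_open f P & basic_open f `<=` W.
Proof.
move=> [E ->] /= nEP; apply: contrapT => nf; apply: nEP => e Ee.
apply: contrapT => nPe; apply: nf; exists e => // Q nQe sEQ.
by apply: nQe; exact: sEQ.
Qed.

Section Contraction.
Variables (A C : comPzRingType) (f : A) (rho : {rmorphism A -> C}).
Hypothesis hrho : is_localization (powers f) rho.

Definition contraction (Q : prime_spectrum C) : prime_spectrum A :=
  PrimeSpectrum (preimage_prime rho (prime_setP Q)).

Lemma localization_unit : exists v, rho f * v = 1.
Proof. by case: hrho => + _ _; apply; exists 1%N; rewrite ?expr1. Qed.

Lemma localization_unit_prime (Q : set C) : prime_ideal Q -> ~ Q (rho f).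
Proof.
move=> pQ Qf; have [v fv] := localization_unit; apply: (prime1 pQ).
by rewrite -fv; apply: idealMr => //; exact: prime_ideal_ideal.
Qed.

Lemma localization_numerator c : exists a n, rho f ^+ n * c = rho a.
Proof.
case: hrho => _ /(_ c)[a [_ [[n _ <-] e]]] _; exists a, n.
by rewrite -rmorphXn.
Qed.

Lemma localization_prime_mem (Q : set C) c a n : prime_ideal Q ->
  rho f ^+ n * c = rho a -> Q c <-> Q (rho a).
Proof.
move=> pQ e; rewrite -e; split=> [Qc|/(primeMl pQ)].
  by apply: idealMl => //; exact: prime_ideal_ideal.
by apply; apply: primeX => //; exact: localization_unit_prime.
Qed.

Lemma contraction_inj : injective contraction.
Proof.
move=> Q Q' eQ; apply: prime_spectrum_eq; apply/seteqP.
have h a : prime_set Q (rho a) = prime_set Q' (rho a).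
  by move/(congr1 (fun P : prime_spectrum A => prime_set P a)): eQ.
have pQ := prime_setP Q; have pQ' := prime_setP Q'.
split=> c; have [a [n e]] := localization_numerator c.
  by rewrite (localization_prime_mem pQ e) h => /(localization_prime_mem pQ' e).
by rewrite (localization_prime_mem pQ' e) -h => /(localization_prime_mem pQ e).
Qed.

Lemma range_contraction : range contraction = basic_open f.
Proof.
apply/seteqP; split=> [_ [Q _ <-]|P nPf].
  exact: localization_unit_prime (prime_setP Q).
have pP := prime_setP P.
have SP : powers f `<=` ~` P by move=> _ [n _ <-]; exact: primeX.
have S1 : powers f 1 by exists 0%N.
have SM s t : powers f s -> powers f t -> powers f (s * t).
  by move=> [n _ <-] [m _ <-]; exists (n + m)%N; rewrite ?exprD.
exists (PrimeSpectrum (localized_ideal_prime pP S1 SM SP hrho)) => //.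
apply: prime_spectrum_eq; apply/seteqP.
by split=> a /(localized_idealE pP S1 SP hrho).
Qed.

Lemma contraction_basic_open c a n : rho f ^+ n * c = rho a ->
  contraction @` basic_open c = basic_open (f * a).
Proof.
move=> e; apply/seteqP; split=> [_ [Q nQc <-]|P nPfa].
  move=> /=; rewrite /preimage /= rmorphM; apply: primeM.
  - exact: prime_setP.
  - exact: localization_unit_prime (prime_setP Q).
  - by move=> /(localization_prime_mem (prime_setP Q) e).
have iP := prime_ideal_ideal (prime_setP P).
have [Q _ eQ] : range contraction P.
  rewrite range_contraction => Pf; apply: nPfa; exact: idealMr.
exists Q => // /(localization_prime_mem (prime_setP Q) e) Qa; apply: nPfa.
by apply: idealMl => //; rewrite -eQ.
Qed.

Lemma contraction_open (W : set (prime_spectrum C)) :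
  open W -> open (contraction @` W).
Proof.
move=> oW; have -> : contraction @` W =
    \bigcup_(c in [set c | basic_open c `<=` W]) (contraction @` basic_open c).
  apply/seteqP; split=> [_ [Q WQ <-]|_ [c sc [Q Qc <-]]].
    have [c Qc sc] := open_basic_sub oW WQ; exists c => //; by exists Q.
  by exists Q => //; exact: sc.
apply: bigcup_open => c _; have [a [n e]] := localization_numerator c.
by rewrite (contraction_basic_open e); exact: open_basic.
Qed.

Lemma contraction_continuous : continuous contraction.
Proof.
apply/continuousP => _ [E ->]; exists (rho @` E); apply/seteqP.
split=> Q /= nQ sQ; apply: nQ.
  by move=> e Ee; apply: sQ; exists e.
by move=> _ [e Ee <-]; exact: sQ.
Qed.

(** With [c = a / f^n], inverting [c] in [A_f] amounts to inverting [f a] in [A]. *)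
Lemma localization_trans (S : comPzRingType) (sigma : {rmorphism C -> S}) c a n :
  rho f ^+ n * c = rho a ->
  is_localization (powers (f * a)) (fun x => sigma (rho x)) ->
  is_localization (powers c) sigma.
Proof.
move=> e [unitS surjS kerS]; have [v fv] := localization_unit.
have efa : rho (f * a) = rho f ^+ n.+1 * c by rewrite rmorphM -e exprS mulrA.
have vK k x : v ^+ k * (rho f ^+ k * x) = x.
  by rewrite mulrA -exprMn [v * _]mulrC fv expr1n mul1r.
split.
- move=> _ [k _ <-]; have [|b hb] := unitS (f * a); first by exists 1%N;
    rewrite ?expr1.
  exists ((sigma (rho f ^+ n.+1) * b) ^+ k).
  by rewrite rmorphXn -exprMn mulrA -rmorphM [c * _]mulrC -efa hb expr1n.
- move=> b; have [x [_ [[k _ <-] ex]]] := surjS b.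
  exists (v ^+ (n.+1 * k) * rho x), (c ^+ k); split; first by exists k.
  rewrite rmorphM -ex mulrA -rmorphM; congr (sigma _ * _).
  by rewrite rmorphXn efa exprMn -exprM vK.
- move=> c' c'0; have [x [k ex]] := localization_numerator c'.
  have [|_ [l _ <-] lx] := kerS x; first by rewrite -ex rmorphM c'0 mulr0.
  exists (c ^+ l); first by exists l.
  move/(congr1 rho): lx; rewrite rmorphM rmorph0 -ex rmorphXn efa exprMn -exprM.
  move=> /(congr1 (fun z => v ^+ k * (v ^+ (n.+1 * l) * z))); rewrite !mulr0.
  by rewrite -mulrA vK mulrCA vK.
Qed.

End Contraction.

Section Charts.
Variables (X : ringed_space) (U : opens X) (A : comPzRingType).
Variables (phi : prime_spectrum A -> X) (theta : {rmorphism A -> sections U}).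
Hypothesis chart : is_spec_chart phi theta.

Lemma chart_basic_sub f : phi @` basic_open f `<=` U.
Proof. by move=> _ [P _ <-]; rewrite -(chart_range chart); exists P. Qed.

Definition basic_opens f : opens X :=
  Opens (chart_open chart (open_basic f)).

(** The sections over [V] are [A_f], whose primes contract bijectively onto [basic_open f]. Charts
    are normalized to the ring of sections itself, with the identity as ring map. *)
Lemma basic_chart f (V : opens X) (hVU : V `<=` U) :
  opens_set V = phi @` basic_open f ->
  exists psi : prime_spectrum (sections V) -> X,
    is_spec_chart psi (idfun : {rmorphism sections V -> sections V}).
Proof.
move=> eV; pose rho : {rmorphism A -> sections V} := res hVU \o theta.
have hrho : is_localization (powers f) rho by exact (chart_sections chart hVU
  eV).
exists (phi \o contraction rho); split.
- by move=> Q Q' /(chart_inj chart)/(contraction_inj hrho).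
- by rewrite eV -(range_contraction hrho) image_comp.
- move=> Q; apply: continuous_comp; first exact: contraction_continuous.
  exact: (chart_continuous chart).
- move=> W oW; rewrite -image_comp; apply: (chart_open chart).
  exact: (contraction_open hrho).
move=> c V' hV' eV'; have [a [n e]] := localization_numerator hrho c.
apply: (localization_trans hrho e).
have hVU' : V' `<=` U by exact: (subset_trans hV' hVU).
have -> : (fun x => res hV' (rho x)) = (fun x => res hVU' (theta x)).
  by apply/funext => x; exact: res_comp.
apply: (chart_sections chart).
by rewrite eV' -image_comp (contraction_basic_open hrho e).
Qed.

End Charts.

(** Basic open sets are cofinal among the neighbourhoods of the point, so every germ is a fraction
    with denominator outside [P], and a vanishing germ is killed by such a denominator. *)
Lemma stalk_localization (X : ringed_space) (U : opens X)
    (phi : prime_spectrum (sections U) -> X) (P : prime_spectrum (sections U))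
    (B : comPzRingType)
    (germ : forall V : opens X,
      opens_set V (phi P) -> {rmorphism sections V -> B})
    (UP : opens_set U (phi P)) :
  is_spec_chart phi (idfun : {rmorphism sections U -> sections U}) ->
  is_stalk germ -> is_localization (~` prime_set P) (germ U UP).
Proof.
move=> chart [gres gsurj ger0].
have basic (W : opens X) : opens_set W (phi P) ->
  exists (s : sections U) (V : opens X),
    [/\ ~ prime_set P s, opens_set V = phi @` basic_open s, V `<=` W, V `<=` U
      & opens_set V (phi P)].
  move=> WP.
  have oW : open (phi @^-1` W).
    by move/continuousP: (chart_continuous chart); apply; exact: opens_open.
  have [s nPs sW] := open_basic_sub oW WP.
  exists s, (basic_opens chart s); split=> //.
  - by move=> _ [Q sQ <-]; exact: sW.
  - exact: (chart_basic_sub chart (f := s)).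
  - by exists P.
split.
- move=> s nPs; have hVU := chart_basic_sub chart (f := s).
  pose V := basic_opens chart s; have VP : opens_set V (phi P) by exists P.
  have [+ _ _] := chart_sections chart (V := V) hVU erefl.
  move=> /(_ s)[|b sb1]; first by exists 1%N; rewrite ?expr1.
  by exists (germ V VP b); rewrite -(gres U V hVU UP VP) -rmorphM sb1 rmorph1.
- move=> b; have [W [WP [t <-]]] := gsurj b.
  have [s [V [nPs eV hVW hVU VP]]] := basic W WP.
  have [_ /(_ (res hVW t))[a [_ [[n _ <-] e]]] _] :=
    chart_sections chart hVU eV.
  exists a, (s ^+ n); split; first by apply: primeX => //; exact: prime_setP.
  rewrite -(gres W V hVW WP VP) -!(gres U V hVU UP VP) -rmorphM.
  by congr (germ V VP _).
- move=> a /ger0[W [hWU [WP a0]]]; have [s [V [nPs eV hVW hVU VP]]] :=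
    basic W WP.
  have [_ _ ker] := chart_sections chart hVU eV.
  have [|_ [n _ <-] sa0] := ker a; first by rewrite /= -(res_comp hWU hVW) a0
    rmorph0.
  by exists (s ^+ n) => //; apply: primeX => //; exact: prime_setP.
Qed.

Lemma affine_open_chart (X : ringed_space) (U : opens X) : affine_open U ->
  exists phi : prime_spectrum (sections U) -> X,
    is_spec_chart phi (idfun : {rmorphism sections U -> sections U}).
Proof.
move=> [A [phi [theta chart]]].
apply: (basic_chart chart (f := 1) (@subset_refl _ U)).
rewrite -(chart_range chart); congr (phi @` _).
by apply/seteqP; split=> // P _; apply: prime1; exact: prime_setP.
Qed.

Theorem theorem4p11 (k : fieldType) (p : nat) (hp : (p \in [pchar k]%R))
    (Z : variety k) (hZ : regular_scheme Z) (xi : Z) :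
  exists U : opens Z,
    [/\ opens_set U xi, affine_open U
      & exists B : set (sections U), absolute_p_basis p B].
Proof.
have p_pr : prime p by exact: pcharf_prime hp.
have pk0 : p%:R = 0 :> k by exact: pcharf0 hp.
have [n [Us [Us_cover Us_affine]]] := variety_finite_type Z.
have [i _ Uxi] : (\bigcup_i opens_set (Us i)) xi by rewrite Us_cover.
(* The chart is normalized because finite generation over [k] is stated for the ring of sections. *)
have [/affine_open_chart[phi chart] fgen] := Us_affine i.
move: (Us i) Uxi phi chart fgen => U Uxi phi chart fgen.
have [P _ eP] : range phi xi by rewrite (chart_range chart).
have pP := prime_setP P; subst xi.
have [B [germ [stalk regB]]] := hZ (phi P).
pose iota : {rmorphism k -> sections U} :=
  res (U := opens_setT Z) (@subsetT _ U) \o structure_map Z.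
have pU0 : p%:R = 0 :> sections U by rewrite -(rmorph_nat iota) pk0 rmorph0.
have nz : 1 != 0 :> sections U.
  apply/eqP => e; apply: (prime1 pP); rewrite e; apply: ideal0.
  exact: prime_ideal_ideal.
have [R [pi [pR0 nR [BR hBR] pisurj]]] :=
  @finitely_generated_presentation p k (sections U) iota p_pr pk0 nz fgen.
have [T [W hTW]] := residual_p_basis_exists p_pr pU0 pP pR0 nR hBR pisurj.
have hloc := stalk_localization Uxi chart stalk.
have [g nPg hg] := local_p_basis p_pr pU0 pP hloc (noetherian_surj pisurj nR)
  regB hTW.
have hVU := chart_basic_sub chart (f := g).
pose V := basic_opens chart g; have VP : opens_set V (phi P) by exists P.
(* The germ map on [U] factors through the sections over [V], which are the localization at the
   powers of [g]. *)
have [||BV hBV] := hg (sections V) (res (U := U) (V := V) hVU) (germ V VP).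
- by move=> a; exact: (germ_res stalk).
- by exact (chart_sections chart (V := V) hVU erefl).
have [psi chartV] := basic_chart chart (f := g) (V := V) hVU erefl.
exists V; split=> //; first by exists (sections V), psi, idfun.
exists BV; apply: absolute_p_basis_of => //.
by rewrite -(rmorph_nat (res (U := U) (V := V) hVU)) pU0 rmorph0.
Qed.
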